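(* Let $d\ge 2$ and let $G_d(x,t)=\frac{1}{(4\pi t)^{d/2}}e^{-|x|^2/(4t)}$ for $x\in\mathbb{R}^d$, $t>0$. There is a constant $C_d>0$ such that for every $0<\epsilon<0.1$ and every $T\ge 1000\delta>0$ there exist positive integers $$N_1\le C_d\log\frac{T}{\delta}\left(\log\frac1\epsilon+\log\log\frac{T}{\delta}\right),\qquad N_2\le C_d\log\frac1\epsilon\left(\log\frac{T}{\delta}+\log\frac1\epsilon\right),$$ positive reals $\tilde w_j,\lambda_j$ ($j=1,\dots,N_2$), and complex numbers $w_k$ and $s_k\in\mathbb{C}\setminus(-\infty,0]$ ($k=-N_1,\dots,N_1$) such that $$\tilde G_d(x,t)=\sum_{j=1}^{N_2}\tilde w_j e^{-\lambda_j t}\sum_{k=-N_1}^{N_1}w_k e^{s_k t}e^{-\sqrt{s_k}|x|}$$ satisfies $|G_d(x,t)-\tilde G_d(x,t)|<\frac{\epsilon}{t^{d/2}}$ for all $x\in\mathbb{R}^d$ and all $t\in[\delta,T]$.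
   Context: $|x|$ is the Euclidean norm on $\mathbb{R}^d$; $\sqrt{s}$ denotes the principal branch of the square root on $\mathbb{C}\setminus(-\infty,0]$. *)

(* Defs.v *)
From Stdlib Require Import Reals ZArith.
Open Scope R_scope.

Definition Cx : Type := (R * R)%type.
Definition RtoC (r : R) : Cx := (r, 0).
Definition Cplus (a b : Cx) : Cx := (fst a + fst b, snd a + snd b).
Definition Copp (a : Cx) : Cx := (- fst a, - snd a).
Definition Cmult (a b : Cx) : Cx :=
  (fst a * fst b - snd a * snd b, fst a * snd b + snd a * fst b).
Definition Cexp (z : Cx) : Cx :=
  (exp (fst z) * cos (snd z), exp (fst z) * sin (snd z)).
Definition Cmod (z : Cx) : R := sqrt (fst z ^ 2 + snd z ^ 2).
Definition in_slit_plane (z : Cx) : Prop := ~ (snd z = 0 /\ fst z <= 0).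
(* principal square root on C \ (-oo,0]: the root with positive real part,
   a = sqrt((|z| + Re z)/2), b = Im z / (2 a). *)
Definition Csqrt (z : Cx) : Cx :=
  let a := sqrt ((Cmod z + fst z) / 2) in (a, snd z / (2 * a)).

Fixpoint Csum (n : nat) (f : nat -> Cx) : Cx :=
  match n with O => (0, 0) | S m => Cplus (Csum m f) (f m) end.
Fixpoint Rsum (n : nat) (f : nat -> R) : R :=
  match n with O => 0 | S m => Rsum m f + f m end.

(* Euclidean norm of the first d coordinates: x restricted to {0..d-1} is a point of R^d *)
Definition norm_d (d : nat) (x : nat -> R) : R := sqrt (Rsum d (fun i => x i ^ 2)).

Definition heat_kernel (d : nat) (x : nat -> R) (t : R) : R :=
  / Rpower (4 * PI * t) (INR d / 2) * exp (- (norm_d d x ^ 2) / (4 * t)).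

Definition approx_kernel (d N1 N2 : nat) (wt lam : nat -> R) (w s : Z -> Cx)
  (x : nat -> R) (t : R) : Cx :=
  Csum N2 (fun j =>
    Cmult (RtoC (wt (S j) * exp (- lam (S j) * t)))
      (Csum (2 * N1 + 1) (fun i =>
         let k := (Z.of_nat i - Z.of_nat N1)%Z in
         Cmult (w k)
           (Cmult (Cexp (Cmult (s k) (RtoC t)))
                  (Cexp (Copp (Cmult (Csqrt (s k)) (RtoC (norm_d d x))))))))).

(* Main.v *)
(** Up to a constant, [G_d] is the product of [t^(-b)], [b = (d-1)/2], and
    [t^(-1/2) exp (-r^2/(4t))]; each factor is discretized by the trapezoidal rule.

    The first one is [1/Gamma(b)] times the integral over [v] of
    [exp (b v - t e^v)], whose integrand only depends on [v + ln t] up to the factor [t^(-b)].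
    The second one is a multiple of the integral of [exp (z^2 t - z r) dz] along the
    curve [z = mu (cosh u / 2 + i sqrt 3 / 2 sinh u)], the branch in [Re z > 0] of a hyperbola,
    with [mu^2 = ln (1/eps) / T] and [s = z^2].

    Both integrands are combinations of [c e^(n u)] times one fixed exponential of a
    combination of exponentials, so that their [k]-th derivatives are bounded by
    [D^k k!] times an integrable function; taking [m] derivatives with step [h = 1/(e D m)]
    yields the error [e^(-m)] without complex analysis.  The normalizing constants
    ([Gamma(b)] and the Gaussian integral) need not be computed: they are absorbed into
    the weights. *)

(* Coquelicot must come first: its complex numbers would otherwise shadow those of Defs. *)
From Coquelicot Require Import Coquelicot.
Require Import Defs.
From Stdlib Require Import Reals ZArith Lra Lia FunctionalExtensionality.
Open Scope R_scope.

(** The asymptotes of the hyperbola make the angle pi/3 with the real axis, so [z^2] goes to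
    infinity at the angle 2 pi/3 and [exp (z^2 t)] decays doubly exponentially in [u]. Meanwhile
    [Re z > 0] makes [exp (- z r)] harmless for every [r >= 0], so the bounds are uniform in [r],
    and it makes [z] the principal root of [s]. The factor [ln (1/eps)] in [mu^2] balances two
    costs. With [tau = mu^2 t], it gives [tau <= ln (1/eps)], so the growth [exp (tau / 2)] near the
    vertex costs at most [eps^(-1/2)], paid by a larger [m]. It also gives
    [tau >= ln (1/eps) delta / T], so a window of half-length [ln (T/delta) / 2 + O(1)], free of
    [eps], truncates with error [eps]. The term [ln (ln (T/delta))] in [N1] is the price of bounding
    the quadrature error by a maximum times the length of the window. In the power factor the left
    tail [exp (b v)] decays only exponentially, so the window has length
    [ln (T/delta) + O(ln (1/eps))], whence the shape of [N2]. Cauchy's theorem is replaced by an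
    explicit primitive of the contour integrand, made of real integrals along two segments. *)

(** * Finite sums and mean value estimates *)

Lemma Rsum_ext (n : nat) (f g : nat -> R) :
  (forall i, (i < n)%nat -> f i = g i) -> Rsum n f = Rsum n g.
Proof.
  induction n as [|n IH]; simpl; intros H; auto.
  rewrite IH; [rewrite H; auto; lia | intros; apply H; lia].
Qed.

Lemma Rsum_le (n : nat) (f g : nat -> R) :
  (forall i, (i < n)%nat -> f i <= g i) -> Rsum n f <= Rsum n g.
Proof.
  induction n as [|n IH]; simpl; intros H; [lra|].
  apply Rplus_le_compat; [apply IH; intros; apply H; lia | apply H; lia].
Qed.

Lemma Rsum_const (n : nat) (c : R) : Rsum n (fun _ => c) = INR n * c.
Proof. induction n as [|n IH]; [simpl; lra|]. rewrite S_INR; simpl; rewrite IH; lra. Qed.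

Lemma Rsum_scal (n : nat) (c : R) (f : nat -> R) :
  Rsum n (fun i => c * f i) = c * Rsum n f.
Proof. induction n as [|n IH]; simpl; [lra|]. rewrite IH; lra. Qed.

Lemma Rsum_abs (n : nat) (f : nat -> R) : Rabs (Rsum n f) <= Rsum n (fun i => Rabs (f i)).
Proof.
  induction n as [|n IH]; simpl; [rewrite Rabs_R0; lra|].
  eapply Rle_trans; [apply Rabs_triang | lra].
Qed.

Lemma Rsum_nonneg (n : nat) (f : nat -> R) :
  (forall i, (i < n)%nat -> 0 <= f i) -> 0 <= Rsum n f.
Proof.
  intros H; rewrite <- (Rmult_0_r (INR n)), <- Rsum_const; now apply Rsum_le.
Qed.

Lemma Rsum_term_le (n : nat) (f : nat -> R) (i : nat) :
  (forall j, (j < n)%nat -> 0 <= f j) -> (i < n)%nat -> f i <= Rsum n f.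
Proof.
  induction n as [|n IH]; simpl; intros H Hi; [lia|].
  assert (0 <= f n) by (apply H; lia).
  assert (0 <= Rsum n f) by (apply Rsum_nonneg; intros; apply H; lia).
  destruct (Nat.eq_dec i n) as [->|]; [lra|].
  assert (f i <= Rsum n f) by (apply IH; [intros; apply H; lia | lia]). lra.
Qed.

Lemma is_derive_Rsum (n : nat) (f f' : nat -> R -> R) (u : R) :
  (forall i, (i < n)%nat -> is_derive (f i) u (f' i u)) ->
  is_derive (fun u => Rsum n (fun i => f i u)) u (Rsum n (fun i => f' i u)).
Proof.
  induction n as [|n IH]; simpl; intros H.
  - apply @is_derive_const.
  - apply @is_derive_plus; [apply IH; intros; apply H; lia | apply H; lia].
Qed.

Lemma mean_value (f f' : R -> R) (a b : R) : (forall u, is_derive f u (f' u)) ->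
  exists c, Rmin a b <= c <= Rmax a b /\ f b - f a = f' c * (b - a).
Proof.
  intros Hd. apply MVT_gen.
  - intros; apply Hd.
  - intros x _. apply continuity_pt_filterlim, (@ex_derive_continuous _ R_NormedModule).
    eexists; apply Hd.
Qed.

Lemma Rabs_le_of_derive (f f' : R -> R) (K a b : R) :
  (forall u, is_derive f u (f' u)) ->
  (forall u, Rmin a b <= u <= Rmax a b -> Rabs (f' u) <= K) ->
  Rabs (f b - f a) <= K * Rabs (b - a).
Proof.
  intros Hd HK.
  destruct (mean_value f f' a b) as [c [Hc ->]]; [intros; apply Hd|].
  rewrite Rabs_mult. apply Rmult_le_compat_r; [apply Rabs_pos | auto].
Qed.

Lemma le_of_derive (f f' : R -> R) (a b : R) :
  a <= b -> (forall u, is_derive f u (f' u)) -> (forall u, a <= u <= b -> 0 <= f' u) ->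
  f a <= f b.
Proof.
  intros Hab Hd Hp.
  destruct (mean_value f f' a b) as [c [Hc Heq]]; [intros; apply Hd|].
  rewrite Rmin_left, Rmax_right in Hc by lra.
  assert (0 <= f' c * (b - a)) by (apply Rmult_le_pos; [apply Hp|]; lra). lra.
Qed.

(** With [exp x - 1] in place of [exp x], the difference vanishes at 0, and its derivative is [S j]
    times the difference controlled by the induction hypothesis. *)
Lemma pow_le_fact_exp (j : nat) (x : R) : 0 <= x -> x ^ j <= INR (fact j) * exp x.
Proof.
  revert x; induction j as [|j IH]; intros x Hx.
  - simpl. pose proof (exp_ineq1_le x). lra.
  - assert (H : 0 <= INR (fact (S j)) * (exp x - 1) - x ^ S j).
    { replace 0 with (INR (fact (S j)) * (exp 0 - 1) - 0 ^ S j) by (rewrite exp_0; simpl pow; ring).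
      apply (le_of_derive (fun x => INR (fact (S j)) * (exp x - 1) - x ^ S j)
       (fun x => INR (S j) * (INR (fact j) * exp x - x ^ j))); auto.
      - intros u. auto_derive; auto.
        change (fact j + j * fact j)%nat with (fact (S j)).
        rewrite fact_simpl, mult_INR. change (match j with O => 1 | S _ => INR j + 1 end) with (INR (S j)). ring.
      - intros u [Hu _]. apply Rmult_le_pos; [apply pos_INR|]. specialize (IH u Hu). lra. }
    assert (0 < INR (fact (S j))) by apply INR_fact_lt_0. nra.
Qed.

(** * Trapezoidal rule *)

Section Trapezoid.
Variables (g : nat -> R -> R) (a h : R) (n : nat).
Hypothesis Hg : forall k u, is_derive (g k) u (g (S k) u).
Hypothesis Hh : 0 < h.

(** Here [g 0] is a primitive of the integrand [g 1], so [h * H 1 0] is the quadrature sum and [B 0]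
    the integral. Letting the nodes slide by [v] turns the error into one-variable calculus:
    [H (S k)] is the derivative of [H k], whose increment over one step telescopes to [B k]. *)
Let H (k : nat) (v : R) := Rsum n (fun j => g k (a + v + INR j * h)).
Let B (k : nat) := g k (a + INR n * h) - g k a.

Lemma shifted_sum_derive k v : is_derive (H k) v (H (S k) v).
Proof.
  unfold H. apply (is_derive_Rsum n (fun j v => g k (a + v + INR j * h))
    (fun j v => g (S k) (a + v + INR j * h))).
  intros i _.
  replace (g (S k) (a + v + INR i * h)) with (scal 1 (g (S k) (a + v + INR i * h)))
    by (unfold scal; simpl; unfold mult; simpl; ring).
  apply (is_derive_comp (g k) (fun v => a + v + INR i * h)); [apply Hg|].
  auto_derive; auto.
Qed.

Lemma shifted_sum_telescope k : H k h - H k 0 = B k.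
Proof.
  unfold H, B. clear. induction n as [|p IH]; [simpl; rewrite Rmult_0_l, Rplus_0_r; ring|].
  rewrite S_INR. simpl.
  replace (a + (INR p + 1) * h) with (a + h + INR p * h) by ring.
  rewrite Rplus_0_r. rewrite Rplus_0_r in IH. lra.
Qed.

(* By the mean value theorem [h * H (S k)] equals [B k] somewhere in [0, h]. *)
Lemma shifted_sum_step k Y :
  (forall v, 0 <= v <= h -> Rabs (h * H (S (S k)) v) <= Y) ->
  forall v, 0 <= v <= h -> Rabs (h * H (S k) v - B k) <= h * Y.
Proof.
  intros HY v Hv.
  destruct (mean_value (H k) (H (S k)) 0 h) as [c [Hc Heq]]; [intros; apply shifted_sum_derive|].
  rewrite Rmin_left, Rmax_right in Hc by lra.
  rewrite <- shifted_sum_telescope, Heq.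
  replace (h * H (S k) v - H (S k) c * (h - 0)) with (h * (H (S k) v - H (S k) c)) by ring.
  rewrite Rabs_mult, (Rabs_right h) by lra.
  apply Rmult_le_compat_l; [lra|].
  assert (0 <= Y) by (eapply Rle_trans; [apply Rabs_pos | apply (HY 0); lra]).
  eapply Rle_trans.
  + apply (Rabs_le_of_derive (H (S k)) (H (S (S k))) (Y / h)).
    * apply shifted_sum_derive.
    * intros u Hu.
      assert (0 <= u <= h).
      { split; [eapply Rle_trans; [|apply Hu]; apply Rmin_glb; lra
               |eapply Rle_trans; [apply Hu|]; apply Rmax_lub; lra]. }
      specialize (HY u H1). rewrite Rabs_mult, (Rabs_right h) in HY by lra.
      apply Rmult_le_reg_l with h; [lra|].
      replace (h * (Y / h)) with Y by (field; lra). exact HY.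
  + replace Y with (Y / h * h) at 2 by (field; lra).
    apply Rmult_le_compat_l; [apply Rdiv_le_0_compat; lra|].
    apply Rabs_le; lra.
Qed.

(** Iterates [shifted_sum_step], bounding [h * H] at the next order by its own [B] plus its own
    error. This is a crude Euler-Maclaurin formula with all Bernoulli coefficients replaced by 1.
    The sum runs from the highest order down, so that each induction step appends its term at the
    end. *)
Lemma euler_maclaurin_bound m : forall k Y,
  (forall v, 0 <= v <= h -> Rabs (h * H (k + m + 2) v) <= Y) ->
  forall v, 0 <= v <= h -> Rabs (h * H (S k) v - B k)
    <= Rsum m (fun i => h ^ (m - i) * Rabs (B (k + m - i))) + h ^ S m * Y.
Proof.
  induction m as [|m IH]; intros k Y HY v Hv.
  - simpl. rewrite Rmult_1_r, Rplus_0_l. apply shifted_sum_step; auto.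
    intros; replace (S (S k)) with (k + 0 + 2)%nat by lia; auto.
  - eapply Rle_trans; [apply shifted_sum_step with (v := v); auto|].
    + intros v' Hv'.
      specialize (IH (S k) Y).
      replace (S k + m + 2)%nat with (k + S m + 2)%nat in IH by lia.
      specialize (IH HY v' Hv').
      instantiate (1 := Rabs (B (S k)) + (Rsum m (fun i => h ^ (m - i) * Rabs (B (S k + m - i))) + h ^ S m * Y)).
      replace (h * H (S (S k)) v') with (B (S k) + (h * H (S (S k)) v' - B (S k))) by ring.
      eapply Rle_trans; [apply Rabs_triang | lra].
    + apply Req_le. cbn [Rsum].
      rewrite (Rsum_ext m (fun i => h ^ (S m - i) * Rabs (B (k + S m - i)))
        (fun i => h * (h ^ (m - i) * Rabs (B (S k + m - i))))).
      * rewrite Rsum_scal. replace (S m - m)%nat with 1%nat by lia.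
        replace (k + S m - m)%nat with (S k) by lia. simpl. ring.
      * intros i Hi. replace (S m - i)%nat with (S (m - i)) by lia.
        replace (k + S m - i)%nat with (S k + m - i)%nat by lia. simpl; ring.
Qed.
End Trapezoid.

(* Derivatives growing like D^k k! make the h^k-terms geometric as soon as h D m <= 1/e. *)
Lemma trapezoid_error (f P G : R -> R) (a h D X : R) (n m : nat) :
  (forall u, is_derive P u (f u)) ->
  (forall k u, ex_derive (Derive_n f k) u) ->
  (forall k u, Rabs (Derive_n f k u) <= D ^ k * INR (fact k) * G u) ->
  1 <= D -> 0 < h -> (1 <= m)%nat -> h * D * INR m <= exp (-1) ->
  (forall v, 0 <= v <= h -> h * Rsum n (fun j => G (a + v + INR j * h)) <= X) ->
  Rabs (h * Rsum n (fun j => f (a + INR j * h)) - (P (a + INR n * h) - P a))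
  <= G a + G (a + INR n * h) + exp (- INR m) * X.
Proof.
  intros HP Hf HG HD Hh Hm Hsmall HX.
  set (g := fun k => match k with O => P | S k => Derive_n f k end).
  assert (Hg : forall k u, is_derive (g k) u (g (S k) u)).
  { intros [|k] u; [apply HP|]. simpl. apply Derive_correct, Hf. }
  assert (HG0 : forall u, 0 <= G u).
  { intros u. specialize (HG 0%nat u). simpl in HG.
    pose proof (Rabs_pos (f u)). lra. }
  assert (He : exp (-1) <= 1) by (rewrite <- exp_0; apply Rlt_le, exp_increasing; lra).
  assert (Hm1 : 1 <= INR m) by (change 1 with (INR 1); apply le_INR; auto).
  set (q := h * D * INR m) in *.
  assert (HhD : 0 < h * D) by nra.
  assert (Hq : 0 < q) by (unfold q; nra).
  (* Since [k! <= m^k] for [k <= m], all orders up to [m] are controlled by powers of the single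
     ratio [q <= 1/e]. *)
  assert (Hfact : forall k, (k <= m)%nat -> h ^ k * (D ^ k * INR (fact k)) <= q ^ k).
  { intros k Hk. unfold q. rewrite (Rpow_mult_distr (h * D)), (Rpow_mult_distr h).
    rewrite <- Rmult_assoc. apply Rmult_le_compat_l.
    - rewrite <- Rpow_mult_distr. apply pow_le; lra.
    - clear - Hk. induction k as [|k IH]; [simpl; lra|].
      rewrite fact_simpl, mult_INR. cbn [pow].
      apply Rmult_le_compat; [apply pos_INR | apply pos_INR | apply le_INR; lia | apply IH; lia]. }
  (* The family [g] starts at the primitive, so after this shift [g (m + 2)] is the derivative of
     [f] of order [S m], the full number of derivatives allowed. *)
  destruct m as [|m]; [lia|].
  pose proof (euler_maclaurin_bound g a h n Hg Hh m 0 (D ^ S m * INR (fact (S m)) * X)) as E.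
  simpl in E.
  assert (E' := fun Y => E Y 0 (conj (Rle_refl 0) (Rlt_le _ _ Hh))). clear E.
  rewrite (Rsum_ext n (fun j => f (a + INR j * h)) (fun j => f (a + 0 + INR j * h)))
    by (intros; rewrite Rplus_0_r; auto).
  eapply Rle_trans; [apply E'|].
  - intros v Hv. replace (m + 2)%nat with (S (S m)) by lia.
    rewrite Rabs_mult, (Rabs_right h) by lra.
    apply Rle_trans with (h * Rsum n (fun j => D ^ S m * INR (fact (S m)) * G (a + v + INR j * h))).
    + apply Rmult_le_compat_l; [lra|].
      eapply Rle_trans; [apply Rsum_abs|]. apply Rsum_le. intros i _. apply (HG (S m)).
    + rewrite Rsum_scal.
      replace (h * (D ^ S m * INR (fact (S m)) * Rsum n (fun j => G (a + v + INR j * h))))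
        with (D ^ S m * INR (fact (S m)) * (h * Rsum n (fun j => G (a + v + INR j * h)))) by ring.
      apply Rmult_le_compat_l; [|auto].
      apply Rmult_le_pos; [apply (pow_le D (S m)); lra | apply pos_INR].
  - apply Rplus_le_compat.
    (* A boundary term has one more power of [h] than its derivative order, hence is at most
       [h * (G a + G b)] at the two ends; as [h * m <= q <= 1], all of them together cost only
       [G a + G b]. *)
    + apply Rle_trans with (Rsum m (fun _ => h * (G a + G (a + INR n * h)))).
      * apply Rsum_le. intros i Hi.
        set (k := (m - i - 1)%nat). replace (m - i)%nat with (S k) by (unfold k; lia).
        simpl.
        replace (h * h ^ k * Rabs (Derive_n f k (a + INR n * h) - Derive_n f k a))
          with (h * (h ^ k * Rabs (Derive_n f k (a + INR n * h) - Derive_n f k a))) by ring.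
        apply Rmult_le_compat_l; [lra|].
        apply Rle_trans with (h ^ k * (D ^ k * INR (fact k)) * (G a + G (a + INR n * h))).
        -- rewrite Rmult_assoc. apply Rmult_le_compat_l; [apply pow_le; lra|].
           unfold Rminus. eapply Rle_trans; [apply Rabs_triang|]. rewrite Rabs_Ropp.
           pose proof (HG k a). pose proof (HG k (a + INR n * h)). lra.
        -- rewrite <- (Rmult_1_l (G a + G (a + INR n * h))) at 2.
           apply Rmult_le_compat_r; [apply Rplus_le_le_0_compat; apply HG0|].
           eapply Rle_trans; [apply Hfact; unfold k; lia|].
           rewrite <- (pow1 k). apply pow_incr; lra.
      * rewrite Rsum_const, <- Rmult_assoc.
        rewrite <- (Rmult_1_l (G a + G (a + INR n * h))) at 2.
        apply Rmult_le_compat_r; [apply Rplus_le_le_0_compat; apply HG0|].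
        assert (INR m <= INR (S m)) by (apply le_INR; lia).
        assert (h * INR (S m) <= q).
        { unfold q. replace (h * D * INR (S m)) with (D * (h * INR (S m))) by ring.
          assert (0 <= h * INR (S m)) by (apply Rmult_le_pos; lra). nra. }
        assert (h * INR m <= h * INR (S m)) by (apply Rmult_le_compat_l; lra). lra.
    + change (h * h ^ m) with (h ^ S m).
      change ((D * D ^ m)) with (D ^ S m).
      change (INR (fact m + m * fact m)) with (INR (fact (S m))).
      rewrite <- Rmult_assoc.
      apply Rmult_le_compat_r.
      * eapply Rle_trans; [|apply (HX 0); lra].
        apply Rmult_le_pos; [lra|]. apply Rsum_nonneg; intros; apply HG0.
      * eapply Rle_trans; [apply Hfact; lia|].
        apply Rle_trans with (exp (-1) ^ S m); [apply pow_incr; lra|].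
        rewrite <- Rpower_pow by apply exp_pos. unfold Rpower.
        rewrite ln_exp. apply Req_le; f_equal.
        change (match m with O => 1 | S _ => INR m + 1 end) with (INR (S m)). ring.
Qed.

(** * Derivatives of waves *)

Definition expsum (p : nat) (c e : nat -> R) (u : R) : R :=
  Rsum p (fun i => c i * exp (e i * u)).

(** This is the real part of [c exp (i th + n u)] times the exponential of the sum of
    [(a_j + i b_j) exp (e_j u)]. The phase [th] keeps the class real and closed under
    differentiation: a factor [i] brought down from the exponent is a phase shift by [PI / 2]. *)
Definition wave (p : nat) (a b e : nat -> R) (c n th : R) (u : R) : R :=
  c * exp (n * u + expsum p a e u) * cos (expsum p b e u + th).

(* With R = expsum p a e, S = expsum p s e and |a|, |b| <= s, the weight W makes
   |f| <= W base exp (R + kap S): a wave of degree j in S is charged j!/kap^j because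
   S^j <= j!/kap^j exp (kap S).  Differentiating raises the degree by one, which costs a
   factor at most linear in k. *)
Inductive wave_comb (p : nat) (a b s e : nat -> R) (base : R -> R) (K0 kap : R)
  : nat -> R -> (R -> R) -> Prop :=
| wc_wave k j c n th w : (j <= k)%nat -> Rabs n <= K0 + 2 * INR j -> 0 <= w ->
    (forall u, Rabs c * exp (n * u) <= w * (base u * expsum p s e u ^ j)) ->
    wave_comb p a b s e base K0 kap k (w * (INR (fact j) / kap ^ j)) (wave p a b e c n th)
| wc_plus k W1 W2 f1 f2 : wave_comb p a b s e base K0 kap k W1 f1 ->
    wave_comb p a b s e base K0 kap k W2 f2 ->
    wave_comb p a b s e base K0 kap k (W1 + W2) (fun u => f1 u + f2 u)
| wc_weaken k W W' f : wave_comb p a b s e base K0 kap k W f -> W <= W' ->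
    wave_comb p a b s e base K0 kap k W' f.

Lemma is_derive_expsum p c e u :
  is_derive (expsum p c e) u (expsum p (fun i => c i * e i) e u).
Proof.
  unfold expsum.
  apply (is_derive_Rsum p (fun i u => c i * exp (e i * u)) (fun i u => c i * e i * exp (e i * u))).
  intros i _. auto_derive; auto. ring.
Qed.

Lemma is_derive_wave p a b e c n th u :
  is_derive (wave p a b e c n th) u
    (wave p a b e (c * n) n th u
     + Rsum p (fun i => wave p a b e (c * (a i * e i)) (n + e i) th u
                        + wave p a b e (c * (b i * e i)) (n + e i) (th + PI / 2) u)).
Proof.
  unfold wave.
  pose proof (is_derive_expsum p a e u) as Ha.
  pose proof (is_derive_expsum p b e u) as Hb.
  assert (Ea : ex_derive (expsum p a e) u) by (eexists; apply Ha).
  assert (Eb : ex_derive (expsum p b e) u) by (eexists; apply Hb).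
  auto_derive; auto.
  replace (Derive _ u) with (expsum p (fun i => a i * e i) e u) by (symmetry; now apply is_derive_unique).
  replace (Derive _ u) with (expsum p (fun i => b i * e i) e u) by (symmetry; now apply is_derive_unique).
  match goal with |- _ = _ + ?Q => replace Q with
    (exp (n * u + expsum p a e u) * c * cos (expsum p b e u + th) * expsum p (fun i => a i * e i) e u
     - exp (n * u + expsum p a e u) * c * sin (expsum p b e u + th) * expsum p (fun i => b i * e i) e u) end.
  - ring.
  - generalize (expsum p a e u) as Ra, (expsum p b e u) as Ib. intros Ra Ib.
    unfold expsum. clear. induction p as [|p IH]; simpl; [ring|].
    rewrite <- IH.
    replace (Ib + (th + PI / 2)) with (PI / 2 + (Ib + th)) by ring.
    replace (cos (PI / 2 + (Ib + th))) with (- sin (Ib + th)) by (rewrite (sin_cos (Ib + th)); ring).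
    replace ((n + e p) * u + Ra) with (n * u + Ra + e p * u) by ring.
    rewrite !exp_plus. ring.
Qed.

Section WaveComb.
Variables (p : nat) (a b s e : nat -> R) (base : R -> R) (K0 kap : R).
Hypothesis Ha : forall i, (i < p)%nat -> Rabs (a i) <= s i.
Hypothesis Hb : forall i, (i < p)%nat -> Rabs (b i) <= s i.
Hypothesis He : forall i, (i < p)%nat -> Rabs (e i) <= 2.
Hypothesis Hbase : forall u, 0 <= base u.
Hypothesis Hkap : 0 < kap <= 1.
Hypothesis HK0 : 0 <= K0.

Let good := wave_comb p a b s e base K0 kap.

Lemma expsum_nonneg u : 0 <= expsum p s e u.
Proof.
  apply Rsum_nonneg. intros i Hi. apply Rmult_le_pos; [|apply Rlt_le, exp_pos].
  eapply Rle_trans; [apply Rabs_pos | apply Ha; auto].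
Qed.

Lemma wave_comb_bound k W f : good k W f ->
  forall u, Rabs (f u) <= W * (base u * exp (expsum p a e u + kap * expsum p s e u)).
Proof.
  induction 1 as [k j c n th w Hj Hn Hw Hc | k W1 W2 f1 f2 _ IH1 _ IH2 | k W W' f _ IH HW]; intros u.
  - unfold wave. rewrite !Rabs_mult, (Rabs_right (exp _)) by (apply Rle_ge, Rlt_le, exp_pos).
    rewrite !exp_plus.
    assert (Hcos : Rabs (cos (expsum p b e u + th)) <= 1) by (apply Rabs_le, COS_bound).
    set (E := exp (expsum p a e u)). set (S := expsum p s e u).
    assert (HE : 0 < E) by apply exp_pos.
    assert (HS : 0 <= S) by apply expsum_nonneg.
    assert (HSj : S ^ j <= INR (fact j) / kap ^ j * exp (kap * S)).
    { pose proof (pow_le_fact_exp j (kap * S)) as P.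
      rewrite Rpow_mult_distr in P.
      assert (0 < kap ^ j) by (apply pow_lt; lra).
      apply Rmult_le_reg_l with (kap ^ j); auto.
      replace (kap ^ j * (INR (fact j) / kap ^ j * exp (kap * S)))
        with (INR (fact j) * exp (kap * S)) by (field; lra).
      apply P. apply Rmult_le_pos; lra. }
    apply Rle_trans with (Rabs c * exp (n * u) * E * 1).
    + replace (Rabs c * (exp (n * u) * E)) with (Rabs c * exp (n * u) * E) by ring.
      apply Rmult_le_compat_l; auto.
      repeat apply Rmult_le_pos; try lra; [apply Rabs_pos | apply Rlt_le, exp_pos].
    + rewrite Rmult_1_r.
      apply Rle_trans with (w * (base u * S ^ j) * E).
      * apply Rmult_le_compat_r; [lra | apply Hc].
      * apply Rle_trans with (w * (base u * (INR (fact j) / kap ^ j * exp (kap * S))) * E); [|right; ring].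
        apply Rmult_le_compat_r; [lra|]. apply Rmult_le_compat_l; auto.
        apply Rmult_le_compat_l; auto.
  - eapply Rle_trans; [apply Rabs_triang|]. specialize (IH1 u). specialize (IH2 u). lra.
  - eapply Rle_trans; [apply IH|]. apply Rmult_le_compat_r; auto.
    apply Rmult_le_pos; auto. apply Rlt_le, exp_pos.
Qed.

Lemma wave_comb_Rsum k q W F : (forall i, (i < q)%nat -> good k (W i) (F i)) ->
  good k (Rsum q W) (fun u => Rsum q (fun i => F i u)).
Proof.
  induction q as [|q IH]; simpl; intros H.
  (* The zero function enters the class as a wave of amplitude 0. *)
  - replace (fun _ : R => 0) with (wave p a b e 0 0 0).
    + apply wc_weaken with (0 * (INR (fact 0) / kap ^ 0)); [|lra].
      apply wc_wave; try lia; try lra.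
      * rewrite Rabs_R0; simpl; lra.
      * intros; rewrite Rabs_R0; lra.
    + apply functional_extensionality; intros; unfold wave; ring.
  - apply wc_plus; [apply IH; intros; apply H; lia | apply H; lia].
Qed.

(** For a wave of degree [j <= k], differentiating [exp (n u)] costs [|n| <= K0 + 2 j]. The exponent
    contributes [2 p] new waves, each with a factor [|e i| <= 2] and the ratio [(j + 1) / kap] of
    consecutive weights. The total is at most [growth * (k + 1)]. *)
Definition growth := K0 + 2 + 4 * INR p / kap.

Lemma wave_comb_derive k W f : good k W f ->
  exists f', (forall u, is_derive f u (f' u)) /\ good (S k) (W * (growth * INR (S k))) f'.
Proof.
  induction 1 as [k j c n th w Hj Hn Hw Hc | k W1 W2 f1 f2 H1 IH1 H2 IH2 | k W W' f _ IH HW].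
  - eexists; split; [intros u; apply is_derive_wave|].
    assert (Hjk : INR j <= INR k) by (apply le_INR; lia).
    pose proof (pos_INR j) as Hj0. pose proof (pos_INR p) as Hp0.
    set (A := INR (fact j) / kap ^ j).
    assert (HA : 0 <= A) by (apply Rdiv_le_0_compat; [apply pos_INR | apply pow_lt; lra]).
    assert (HA' : INR (fact (S j)) / kap ^ (S j) = A * (INR j + 1) / kap).
    { unfold A. rewrite fact_simpl, mult_INR, S_INR. simpl. field. split; [apply pow_nonzero|]; lra. }
    apply wc_weaken with (w * (K0 + 2 * INR j) * A
      + Rsum p (fun i => 2 * w * (INR (fact (S j)) / kap ^ S j) + 2 * w * (INR (fact (S j)) / kap ^ S j))).
    + apply wc_plus.
      * apply wc_wave; try lia; auto.
        -- apply Rmult_le_pos; lra.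
        -- intros u. rewrite Rabs_mult. specialize (Hc u).
           apply Rle_trans with (Rabs n * (w * (base u * expsum p s e u ^ j))).
           ++ replace (Rabs c * Rabs n * exp (n * u)) with (Rabs n * (Rabs c * exp (n * u))) by ring.
              apply Rmult_le_compat_l; [apply Rabs_pos | auto].
           ++ replace (w * (K0 + 2 * INR j) * (base u * expsum p s e u ^ j))
                with ((K0 + 2 * INR j) * (w * (base u * expsum p s e u ^ j))) by ring.
              apply Rmult_le_compat_r; auto.
              apply Rmult_le_pos; auto. apply Rmult_le_pos; auto.
              apply pow_le, expsum_nonneg.
      * apply (wave_comb_Rsum (S k) p (fun i => 2 * w * (INR (fact (S j)) / kap ^ S j) + 2 * w * (INR (fact (S j)) / kap ^ S j))
          (fun i u => wave p a b e (c * (a i * e i)) (n + e i) th u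
                        + wave p a b e (c * (b i * e i)) (n + e i) (th + PI / 2) u)).
        intros i Hi.
        assert (Hterm : forall y, Rabs y <= s i -> forall u, Rabs (c * (y * e i)) * exp ((n + e i) * u)
          <= 2 * w * (base u * expsum p s e u ^ S j)).
        { intros y Hy u. rewrite Rmult_plus_distr_r, exp_plus, !Rabs_mult.
          replace (Rabs c * (Rabs y * Rabs (e i)) * (exp (n * u) * exp (e i * u)))
            with (Rabs c * exp (n * u) * (Rabs (e i) * (Rabs y * exp (e i * u)))) by ring.
          replace (2 * w * (base u * expsum p s e u ^ S j))
            with (w * (base u * expsum p s e u ^ j) * (2 * expsum p s e u)) by (simpl; ring).
          pose proof (exp_pos (n * u)). pose proof (exp_pos (e i * u)).
          pose proof (Rabs_pos c). pose proof (Rabs_pos y). pose proof (Rabs_pos (e i)).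
          apply Rmult_le_compat; auto.
          - apply Rmult_le_pos; lra.
          - apply Rmult_le_pos; [lra|]. apply Rmult_le_pos; lra.
          - apply Rmult_le_compat; [lra | apply Rmult_le_pos; lra | auto|].
            apply Rle_trans with (s i * exp (e i * u)); [apply Rmult_le_compat_r; lra|].
            apply (Rsum_term_le p (fun i => s i * exp (e i * u))); auto.
            intros l Hl. apply Rmult_le_pos; [|apply Rlt_le, exp_pos].
            eapply Rle_trans; [apply Rabs_pos | apply (Ha l); auto]. }
        assert (Hn' : Rabs (n + e i) <= K0 + 2 * INR (S j)).
        { rewrite S_INR. eapply Rle_trans; [apply Rabs_triang|]. specialize (He i Hi). lra. }
        apply wc_plus; apply wc_wave; try lia; auto; try lra.
    + rewrite Rsum_const, HA'. fold A. unfold growth. rewrite S_INR.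
      replace (w * (K0 + 2 * INR j) * A + INR p * (2 * w * (A * (INR j + 1) / kap) + 2 * w * (A * (INR j + 1) / kap)))
        with (w * A * ((K0 + 2 * INR j) + 4 * INR p / kap * (INR j + 1))) by (field; lra).
      apply Rmult_le_compat_l; [apply Rmult_le_pos; auto|].
      assert (0 <= 4 * INR p / kap) by (apply Rdiv_le_0_compat; lra).
      assert (4 * INR p / kap * (INR j + 1) <= 4 * INR p / kap * (INR k + 1)) by (apply Rmult_le_compat_l; lra).
      assert (0 <= K0 * INR k) by (apply Rmult_le_pos; lra).
      lra.
  - destruct IH1 as [f1' [D1 G1]], IH2 as [f2' [D2 G2]].
    exists (fun u => f1' u + f2' u). split.
    + intros u. apply @is_derive_plus; auto.
    + rewrite Rmult_plus_distr_r. now apply wc_plus.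
  - destruct IH as [f' [D G]]. exists f'; split; auto.
    eapply wc_weaken; [apply G|].
    apply Rmult_le_compat_r; auto. unfold growth.
    apply Rmult_le_pos; [|apply pos_INR].
    assert (0 <= 4 * INR p / kap) by (apply Rdiv_le_0_compat; [pose proof (pos_INR p)|]; lra). lra.
Qed.

Lemma wave_comb_Derive_n f W : good 0 W f ->
  forall k, good k (W * (growth ^ k * INR (fact k))) (Derive_n f k) /\ forall u, ex_derive (Derive_n f k) u.
Proof.
  intros H0.
  assert (H : forall k, good k (W * (growth ^ k * INR (fact k))) (Derive_n f k)).
  { induction k as [|k IH].
    - simpl. replace (W * (1 * 1)) with W by ring. exact H0.
    - destruct (wave_comb_derive _ _ _ IH) as [f' [D G]].
      replace (Derive_n f (S k)) with f'.
      + replace (W * (growth ^ S k * INR (fact (S k)))) with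
          (W * (growth ^ k * INR (fact k)) * (growth * INR (S k))); auto.
        rewrite fact_simpl, mult_INR. simpl pow. ring.
      + apply functional_extensionality; intros u. simpl. symmetry. now apply is_derive_unique. }
  intros k; split; auto. intros u.
  destruct (wave_comb_derive _ _ _ (H k)) as [f' [D _]]. eexists; apply D.
Qed.

Lemma growth_ge1 : 1 <= growth.
Proof.
  unfold growth.
  assert (0 <= 4 * INR p / kap) by (apply Rdiv_le_0_compat; [pose proof (pos_INR p)|]; lra). lra.
Qed.

(** One majorant [G] of the function serves all its derivatives, because [kap] is fixed once and the
    order only enters through [growth ^ k * k!]. *)
Lemma wave_trapezoid_error (f P G : R -> R) (x h X : R) (n m : nat) (W : R) :
  good 0 W f ->
  (forall u, is_derive P u (f u)) ->
  (forall u, W * (base u * exp (expsum p a e u + kap * expsum p s e u)) <= G u) ->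
  0 < h -> (1 <= m)%nat -> h * growth * INR m <= exp (-1) ->
  (forall v, 0 <= v <= h -> h * Rsum n (fun j => G (x + v + INR j * h)) <= X) ->
  Rabs (h * Rsum n (fun j => f (x + INR j * h)) - (P (x + INR n * h) - P x))
  <= G x + G (x + INR n * h) + exp (- INR m) * X.
Proof.
  intros Hf HP HG Hh Hm Hs HX.
  apply trapezoid_error with (D := growth); auto.
  - intros; apply (wave_comb_Derive_n f W Hf).
  - intros k u. destruct (wave_comb_Derive_n f W Hf k) as [Hk _].
    eapply Rle_trans; [apply (wave_comb_bound _ _ _ Hk)|].
    replace (W * (growth ^ k * INR (fact k)) * (base u * exp (expsum p a e u + kap * expsum p s e u)))
      with (growth ^ k * INR (fact k) * (W * (base u * exp (expsum p a e u + kap * expsum p s e u)))) by ring.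
    apply Rmult_le_compat_l; auto.
    apply Rmult_le_pos; [apply pow_le; pose proof growth_ge1; lra | apply pos_INR].
  - apply growth_ge1.
Qed.
End WaveComb.

(** * Powers as sums of exponentials *)

Lemma exp_le (x y : R) : x <= y -> exp x <= exp y.
Proof. intros [H| ->]; [apply Rlt_le, exp_increasing; auto | lra]. Qed.

Lemma ex_antiderivative (f : R -> R) :
  (forall u, ex_derive f u) -> exists P, forall u, is_derive P u (f u).
Proof.
  intros Hf. exists (fun u => RInt f 0 u). intros u.
  apply is_derive_RInt with (a := 0).
  - exists (mkposreal 1 Rlt_0_1). intros y _. apply (@RInt_correct R_CompleteNormedModule).
    apply ex_RInt_continuous. intros z _. apply (@ex_derive_continuous _ R_NormedModule), Hf.
  - apply (@ex_derive_continuous _ R_NormedModule), Hf.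
Qed.

(** The constant [c] is the integral over the line, obtained as the supremum over bounded intervals.
    [Q1] and [- Q2] are primitives of majorants of the tails; their signs stand in for limits at
    infinity and make [Q1 a] and [Q2 b] bounds for the truncated parts. *)
Lemma improper_integral (f P Q1 q1 Q2 q2 : R -> R) :
  (forall u, 0 < f u) -> (forall u, is_derive P u (f u)) ->
  (forall u, is_derive Q1 u (q1 u)) -> (forall u, is_derive Q2 u (- q2 u)) ->
  (forall u, u <= -1 -> f u <= q1 u) -> (forall u, 1 <= u -> f u <= q2 u) ->
  (forall u, 0 <= Q1 u) -> (forall u, 0 <= Q2 u) ->
  exists c, 0 < c /\ forall a b, a <= -1 -> 1 <= b ->
    Rabs (P b - P a - c) <= Q1 a + Q2 b.
Proof.
  intros Hf HP HQ1 HQ2 Hq1 Hq2 H1 H2.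
  assert (Hincr : forall a b, a <= b -> P a <= P b).
  { intros a b Hab. apply (le_of_derive P f); auto. intros; apply Rlt_le, Hf. }
  assert (T1 : forall a a', a' <= a -> a <= -1 -> P a - P a' <= Q1 a).
  { intros a a' H Ha.
    assert (E : Q1 a' - P a' <= Q1 a - P a).
    { apply (le_of_derive (fun u => Q1 u - P u) (fun u => q1 u - f u)); auto.
      - intros u. apply @is_derive_minus; auto.
      - intros u Hu. specialize (Hq1 u). lra. }
    specialize (H1 a'). lra. }
  assert (T2 : forall b b', b <= b' -> 1 <= b -> P b' - P b <= Q2 b).
  { intros b b' H Hb.
    assert (E : - Q2 b - P b <= - Q2 b' - P b').
    { apply (le_of_derive (fun u => - Q2 u - P u) (fun u => - - q2 u - f u)); auto.
      - intros u. apply @is_derive_minus; auto. apply @is_derive_opp; auto.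
      - intros u Hu. specialize (Hq2 u). lra. }
    specialize (H2 b'). lra. }
  assert (T : forall a b a' b', a <= -1 -> 1 <= b -> P b' - P a' <= P b - P a + (Q1 a + Q2 b)).
  { intros a b a' b' Ha Hb.
    assert (P b' <= P b + Q2 b).
    { destruct (Rle_dec b b') as [h|h]; [specialize (T2 b b' h Hb); lra|].
      specialize (Hincr b' b). specialize (H2 b). lra. }
    assert (P a - Q1 a <= P a').
    { destruct (Rle_dec a' a) as [h|h]; [specialize (T1 a a' h Ha); lra|].
      specialize (Hincr a a'). specialize (H1 a). lra. }
    lra. }
  destruct (completeness (fun y => exists a b, y = P b - P a)) as [c [Hub Hlub]].
  - exists (P 1 - P (-1) + (Q1 (-1) + Q2 1)). intros y [a [b ->]]. apply T; lra.
  - exists (P 0 - P 0), 0, 0; auto.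
  - exists c. split.
    + destruct (mean_value P f 0 1) as [x [_ Hx]]; [intros; apply HP|].
      apply Rlt_le_trans with (P 1 - P 0); [rewrite Hx; specialize (Hf x); lra|].
      apply Hub. eauto.
    + intros a b Ha Hb.
      assert (P b - P a <= c) by (apply Hub; eauto).
      assert (c <= P b - P a + (Q1 a + Q2 b)).
      { apply Hlub. intros y [a' [b' ->]]. apply T; auto. }
      apply Rabs_le; lra.
Qed.

(** Each term is dominated by an increment of the logistic function [L], so the sum telescopes to a
    multiple of a quantity below 1, uniformly in the position and number of nodes. The function [L]
    is smooth at 0, where [|v|] is not; the factor [exp bet] pays for moving the evaluation point by
    at most [h <= 1]. *)
Lemma sum_exp_abs_le (bet : R) : 0 < bet -> exists X, 0 <= X /\ forall v h n, 0 < h <= 1 ->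
  h * Rsum n (fun j => exp (- bet * Rabs (v + INR j * h))) <= X.
Proof.
  intros Hb.
  set (L := fun v => / (1 + exp (- bet * v))).
  set (L' := fun v => bet * exp (- bet * v) * (/ (1 + exp (- bet * v)))^2).
  assert (HL : forall v, is_derive L v (L' v)).
  { intros v. unfold L, L'. pose proof (exp_pos (- bet * v)). auto_derive; [lra|]. field. lra. }
  assert (HL' : forall v, bet / 4 * exp (- bet * Rabs v) <= L' v).
  { intros v. unfold L'. set (E := exp (- bet * v)).
    assert (HE : 0 < E) by apply exp_pos.
    replace (bet * E * (/ (1 + E)) ^ 2) with (bet * (E / (1 + E)^2)) by (field; lra).
    replace (bet / 4 * exp (- bet * Rabs v)) with (bet * (exp (- bet * Rabs v) / 4)) by field.
    apply Rmult_le_compat_l; [lra|].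
    apply Rmult_le_reg_r with ((1 + E)^2); [apply pow_lt; lra|].
    replace (E / (1 + E)^2 * (1 + E)^2) with E by (field; lra).
    unfold Rabs; destruct (Rcase_abs v) as [Hv|Hv].
    - replace (exp (- bet * - v)) with (/ E) by (unfold E; rewrite <- exp_Ropp; f_equal; ring).
      assert (1 <= E) by (unfold E; rewrite <- exp_0; apply exp_le; nra).
      apply Rmult_le_reg_l with (4 * E); [lra|].
      replace (4 * E * (/ E / 4 * (1 + E) ^ 2)) with ((1 + E)^2) by (field; lra). nra.
    - fold E. assert (E <= 1) by (unfold E; rewrite <- exp_0; apply exp_le; nra). nra. }
  exists (4 / bet * exp bet). split.
  { apply Rmult_le_pos; [apply Rdiv_le_0_compat; lra | apply Rlt_le, exp_pos]. }
  intros v h n Hh.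
  assert (Hstep : forall w, h * exp (- bet * Rabs w) <= 4 / bet * exp bet * (L (w + h) - L w)).
  { intros w. destruct (mean_value L L' w (w + h)) as [c [Hc ->]]; [intros; apply HL|].
    rewrite Rmin_left, Rmax_right in Hc by lra.
    assert (Rabs c <= Rabs w + 1).
    { replace c with (w + (c - w)) by ring. eapply Rle_trans; [apply Rabs_triang|].
      assert (Rabs (c - w) <= 1) by (apply Rabs_le; lra). lra. }
    assert (E1 : exp (- bet * Rabs w) <= exp bet * exp (- bet * Rabs c)).
    { rewrite <- exp_plus. apply exp_le. nra. }
    specialize (HL' c).
    assert (E2 : exp (- bet * Rabs c) <= 4 / bet * L' c).
    { apply Rmult_le_reg_l with (bet / 4); [lra|].
      replace (bet / 4 * (4 / bet * L' c)) with (L' c) by (field; lra). auto. }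
    replace (4 / bet * exp bet * (L' c * (w + h - w))) with (h * (exp bet * (4 / bet * L' c))) by ring.
    apply Rmult_le_compat_l; [lra|]. eapply Rle_trans; [apply E1|].
    apply Rmult_le_compat_l; auto. apply Rlt_le, exp_pos. }
  assert (Hsum : h * Rsum n (fun j => exp (- bet * Rabs (v + INR j * h)))
     <= 4 / bet * exp bet * (L (v + INR n * h) - L v)).
  { induction n as [|n IH].
    - simpl. replace (v + 0 * h) with v by ring. lra.
    - rewrite S_INR. simpl. specialize (Hstep (v + INR n * h)).
      replace (v + (INR n + 1) * h) with (v + INR n * h + h) by ring. lra. }
  eapply Rle_trans; [apply Hsum|].
  rewrite <- Rmult_1_r. apply Rmult_le_compat_l.
  { apply Rmult_le_pos; [apply Rdiv_le_0_compat; lra | apply Rlt_le, exp_pos]. }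
  assert (forall w, 0 < L w < 1).
  { intros w. unfold L. pose proof (exp_pos (- bet * w)). split; [apply Rinv_0_lt_compat; lra|].
    rewrite <- Rinv_1 at 2. apply Rinv_lt_contravar; lra. }
  pose proof (H (v + INR n * h)). pose proof (H v). lra.
Qed.

(** Only half of [exp v] is kept because the other half is spent on the derivatives, with
    [kap = 1/2]. For [v >= 0], [exp v / 2 >= v^2 / 4], and the constant [4 bet^2] comes from
    completing the square in [2 bet v - v^2 / 4]. *)
Lemma gamma_integrand_decay (bet v : R) : 0 < bet ->
  bet * v - exp v / 2 <= 4 * bet ^ 2 - bet * Rabs v.
Proof.
  intros Hb. pose proof (exp_pos v).
  unfold Rabs; destruct (Rcase_abs v) as [Hv|Hv]; [nra|].
  pose proof (pow_le_fact_exp 2 v) as P. simpl in P.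
  assert (v * v <= 2 * exp v) by lra.
  assert (0 <= (v / 2 - 2 * bet) ^ 2) by apply pow2_ge_0. nra.
Qed.

(** The constant [c] is the Gamma integral after the substitution of [exp v] for its variable. The
    window enters only through containing [[-M, M]], so one estimate will serve all translates by
    [ln t]. *)
Lemma gamma_trapezoid (bet : R) : 0 < bet -> exists c C D, 0 < c /\ 1 <= C /\ 1 <= D /\
  forall a h M n m, 0 < h <= 1 -> (1 <= m)%nat -> h * D * INR m <= exp (-1) ->
    1 <= M -> a <= - M -> M <= a + INR n * h ->
    Rabs (h * Rsum n (fun j => exp (bet * (a + INR j * h) - exp (a + INR j * h))) - c)
    <= C * (exp (- bet * M) + exp (- INR m)).
Proof.
  intros Hb.
  set (f := fun v => exp (bet * v - exp v)).
  destruct (ex_antiderivative f) as [P HP]; [intros u; unfold f; auto_derive; auto|].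
  set (C0 := exp (4 * bet ^ 2)).
  assert (HC0 : 1 <= C0) by (unfold C0; rewrite <- exp_0; apply exp_le; nra).
  set (G := fun v => C0 * exp (- bet * Rabs v)).
  assert (Hdecay : forall v, exp (bet * v - exp v / 2) <= G v).
  { intros v. unfold G, C0. rewrite <- exp_plus. apply exp_le.
    pose proof (gamma_integrand_decay bet v Hb). lra. }
  assert (HfG : forall v, f v <= G v).
  { intros v. eapply Rle_trans; [|apply Hdecay]. apply exp_le. pose proof (exp_pos v). lra. }
  destruct (improper_integral f P (fun v => C0 / bet * exp (bet * v)) (fun v => C0 * exp (bet * v))
     (fun v => C0 / bet * exp (- bet * v)) (fun v => C0 * exp (- bet * v))) as [c [Hc Htail]]; auto.
  { intros; apply exp_pos. }
  { intros u. auto_derive; auto. field; lra. }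
  { intros u. auto_derive; auto. field; lra. }
  { intros u Hu. eapply Rle_trans; [apply HfG|]. unfold G. rewrite Rabs_left by lra.
    right; do 2 f_equal; ring. }
  { intros u Hu. eapply Rle_trans; [apply HfG|]. unfold G. rewrite Rabs_right by lra. lra. }
  { intros u. apply Rmult_le_pos; [apply Rdiv_le_0_compat; lra | apply Rlt_le, exp_pos]. }
  { intros u. apply Rmult_le_pos; [apply Rdiv_le_0_compat; lra | apply Rlt_le, exp_pos]. }
  destruct (sum_exp_abs_le bet Hb) as [X [HX0 HX]].
  set (D := growth 1 bet (1/2)).
  exists c, (2 * C0 + 2 * C0 / bet + C0 * X), D.
  assert (0 <= C0 / bet) by (apply Rdiv_le_0_compat; lra).
  assert (0 <= C0 * X) by (apply Rmult_le_pos; lra).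
  assert (0 <= 2 * C0 / bet) by lra.
  split; [auto|split; [lra|split]].
  { apply growth_ge1; lra. }
  intros a h M n m Hh Hm Hs HM Ha Hn.
  assert (Hexp : forall v, M <= Rabs v -> exp (- bet * Rabs v) <= exp (- bet * M)).
  { intros v Hv. apply exp_le. nra. }
  assert (Ra : Rabs a = - a) by (apply Rabs_left; lra).
  assert (Rb : Rabs (a + INR n * h) = a + INR n * h) by (apply Rabs_right; lra).
  assert (Etr : Rabs (h * Rsum n (fun j => f (a + INR j * h)) - (P (a + INR n * h) - P a))
    <= G a + G (a + INR n * h) + exp (- INR m) * (C0 * X)).
  (* A single exponential: [R = - exp u], [S = exp u], and [kap = 1/2] leaves
     [R + kap S = - exp u / 2]. *)
  { apply (wave_trapezoid_error 1 (fun _ => -1) (fun _ => 0) (fun _ => 1) (fun _ => 1)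
      (fun u => exp (bet * u)) bet (1/2)) with (W := 1 * (INR (fact 0) / (1/2) ^ 0)); auto; try lra.
    - intros; rewrite Rabs_left; lra.
    - intros; rewrite Rabs_R0; lra.
    - intros; rewrite Rabs_R1; lra.
    - intros; apply Rlt_le, exp_pos.
    - replace f with (wave 1 (fun _ => -1) (fun _ => 0) (fun _ => 1) 1 bet 0).
      + apply wc_wave; auto; try lra.
        * rewrite Rabs_right; simpl; lra.
        * intros u. rewrite Rabs_R1. simpl. lra.
      + apply functional_extensionality. intros u. unfold wave, expsum, f. simpl.
        replace (0 + 0 * exp (1 * u) + 0) with 0 by ring. rewrite cos_0.
        replace (1 * u) with u by ring. rewrite Rmult_1_l, Rmult_1_r. f_equal. ring.
    - intros u. eapply Rle_trans; [|apply Hdecay]. rewrite <- exp_plus. unfold expsum. simpl.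
      replace (1 * (1 / 1)) with 1 by field. rewrite !Rmult_1_l. apply exp_le. lra.
    - intros v Hv.
      unfold G. rewrite Rsum_scal.
      specialize (HX (a + v) h n Hh).
      replace (h * (C0 * Rsum n (fun i => exp (- bet * Rabs (a + v + INR i * h)))))
        with (C0 * (h * Rsum n (fun i => exp (- bet * Rabs (a + v + INR i * h))))) by ring.
      apply Rmult_le_compat_l; lra. }
  fold f in Etr |- *.
  specialize (Htail a (a + INR n * h) ltac:(lra) ltac:(lra)).
  assert (E1 := Hexp a ltac:(lra)). assert (E2 := Hexp (a + INR n * h) ltac:(lra)).
  assert (G a <= C0 * exp (- bet * M)) by (apply Rmult_le_compat_l; lra).
  assert (G (a + INR n * h) <= C0 * exp (- bet * M)) by (apply Rmult_le_compat_l; lra).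
  rewrite Ra in E1. rewrite Rb in E2. replace (- bet * - a) with (bet * a) in E1 by ring.
  assert (C0 / bet * exp (bet * a) <= C0 / bet * exp (- bet * M)) by (apply Rmult_le_compat_l; lra).
  assert (C0 / bet * exp (- bet * (a + INR n * h)) <= C0 / bet * exp (- bet * M)) by (apply Rmult_le_compat_l; lra).
  match goal with |- Rabs (?s - c) <= _ => replace (s - c) with
    ((s - (P (a + INR n * h) - P a)) + (P (a + INR n * h) - P a - c)) by ring end.
  eapply Rle_trans; [apply Rabs_triang|].
  pose proof (exp_pos (- bet * M)). pose proof (exp_pos (- INR m)).
  assert (0 <= C0 * X * exp (- bet * M)) by (apply Rmult_le_pos; lra).
  assert (0 <= C0 * exp (- INR m)) by (apply Rmult_le_pos; lra).
  assert (0 <= C0 / bet * exp (- INR m)) by (apply Rmult_le_pos; lra).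
  unfold f in Etr |- *. lra.
Qed.

(** * Ceilings and logarithms of the parameters *)

Lemma nat_ceil (y : R) : 0 <= y -> exists n, (1 <= n)%nat /\ y <= INR n <= y + 1.
Proof.
  intros Hy. destruct (nfloor_ex y Hy) as [n Hn]. exists (S n). rewrite S_INR. split; [lia | lra].
Qed.

(** Yields [exp 2 <= 9] and [exp 6 <= 729], which stay below the thresholds 10 for [1 / eps] and
    1000 for [T / delta]. *)
Lemma exp_nat_le (k : nat) : exp (INR k) <= 3 ^ k.
Proof.
  replace (INR k) with (INR k * 1) by ring.
  induction k as [|k IH]; [simpl; rewrite Rmult_0_l, exp_0; lra|].
  rewrite S_INR, Rmult_plus_distr_r, exp_plus, Rmult_1_l. simpl.
  pose proof exp_le_3. pose proof (exp_pos (INR k * 1)). pose proof (exp_pos 1). nra.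
Qed.

Lemma ln_inv_eps_ge (eps : R) : 0 < eps -> eps < 0.1 -> 2 <= ln (1 / eps).
Proof.
  intros H1 H2. rewrite <- (ln_exp 2). apply ln_le; [apply exp_pos|].
  pose proof (exp_nat_le 2) as E. simpl in E. replace (1 + 1) with 2 in E by ring.
  assert (9 <= 1 / eps); [|lra].
  apply Rmult_le_reg_r with eps; auto. replace (1 / eps * eps) with 1 by (field; lra). lra.
Qed.

Lemma ln_ratio_ge (T delta : R) : 0 < delta -> 1000 * delta <= T -> 6 <= ln (T / delta).
Proof.
  intros H1 H2. rewrite <- (ln_exp 6). apply ln_le; [apply exp_pos|].
  pose proof (exp_nat_le 6) as E. simpl in E. replace (1 + 1 + 1 + 1 + 1 + 1) with 6 in E by ring.
  assert (1000 <= T / delta); [|lra].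
  apply Rmult_le_reg_r with delta; auto. replace (T / delta * delta) with T by (field; lra). lra.
Qed.

Lemma exp_neg_ln_inv (eps : R) : 0 < eps -> exp (- ln (1 / eps)) = eps.
Proof.
  intros H. rewrite <- ln_Rinv by (apply Rdiv_lt_0_compat; lra).
  rewrite exp_ln; [field; lra | apply Rinv_0_lt_compat, Rdiv_lt_0_compat; lra].
Qed.

Lemma power_sum_of_exponentials (bet : R) : 0 < bet -> exists C, 0 < C /\
  forall eps T delta : R, 0 < eps -> eps < 0.1 -> 0 < delta -> 1000 * delta <= T ->
  exists N : nat, (1 <= N)%nat /\
    INR N <= C * ln (1 / eps) * (ln (T / delta) + ln (1 / eps)) /\
    exists wt lam : nat -> R, (forall j, 0 < wt j /\ 0 < lam j) /\
      forall t, delta <= t <= T ->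
        Rabs (Rsum N (fun j => wt j * exp (- lam j * t)) - Rpower t (- bet))
        <= eps * Rpower t (- bet).
Proof.
  intros Hb. destruct (gamma_trapezoid bet Hb) as [c [C [D [Hc [HC [HD Htr]]]]]].
  (* A loss of [K] in the exponents absorbs the constants: [2 * C * exp (- K) <= c]. *)
  set (K := ln (1 + 2 * C / c)).
  assert (HCc : 0 < 2 * C / c) by (apply Rdiv_lt_0_compat; lra).
  assert (HK : 0 <= K) by (unfold K; rewrite <- ln_1; apply ln_le; lra).
  assert (HKe : 2 * C * exp (- K) <= c).
  { unfold K. rewrite exp_Ropp, exp_ln by lra.
    apply Rmult_le_reg_r with (1 + 2 * C / c); [lra|].
    replace (2 * C * / (1 + 2 * C / c) * (1 + 2 * C / c)) with (2 * C) by (field; lra).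
    replace (c * (1 + 2 * C / c)) with (c + 2 * C) by (field; lra). lra. }
  set (K2 := (1 + K) / bet + 1).
  assert (HK2 : 1 <= K2).
  { unfold K2. assert (0 <= (1 + K) / bet) by (apply Rdiv_le_0_compat; lra). lra. }
  exists (3 * D * (K + 2) * (1 + 2 * K2) + 1).
  assert (HA : 0 <= 3 * D * (K + 2) * (1 + 2 * K2)) by (repeat apply Rmult_le_pos; lra).
  split; [lra|].
  intros eps T delta He1 He2 Hd HT.
  pose proof (ln_inv_eps_ge eps He1 He2) as HL.
  pose proof (ln_ratio_ge T delta Hd HT) as HLam.
  pose proof (exp_neg_ln_inv eps He1) as Heps.
  set (L := ln (1 / eps)) in *. set (Lam := ln (T / delta)) in *.
  destruct (nat_ceil (L + K)) as [m [Hm1 Hm]]; [lra|].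
  (* Solves [exp (- bet * M) <= eps * exp (- K)]; the added 1 ensures [1 <= M]. *)
  set (M := (L + K) / bet + 1).
  assert (HM0 : 0 <= (L + K) / bet) by (apply Rdiv_le_0_compat; lra).
  assert (HM2 : M <= K2 * L).
  { unfold M, K2. rewrite Rmult_plus_distr_r.
    replace ((1 + K) / bet * L) with ((L + K * L) / bet) by (field; lra).
    apply Rplus_le_compat; [|lra]. apply Rmult_le_compat_r; [apply Rlt_le, Rinv_0_lt_compat; lra | nra]. }
  set (h := exp (-1) / (D * INR m)).
  pose proof (exp_pos (-1)) as He.
  assert (He' : exp (-1) <= 1) by (rewrite <- exp_0; apply exp_le; lra).
  assert (HDm : 1 <= D * INR m) by nra.
  assert (Hh : 0 < h <= 1).
  { unfold h. split; [apply Rdiv_lt_0_compat; lra|].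
    apply Rmult_le_reg_r with (D * INR m); [lra|].
    replace (exp (-1) / (D * INR m) * (D * INR m)) with (exp (-1)) by (field; split; lra). lra. }
  destruct (nat_ceil ((Lam + 2 * M) / h)) as [n [Hn1 Hn]].
  { apply Rdiv_le_0_compat; unfold M; lra. }
  exists n. split; auto. split.
  - apply Rle_trans with ((Lam + 2 * M) / h + 1); [lra|].
    replace ((Lam + 2 * M) / h) with ((Lam + 2 * M) * (exp 1 * D * INR m)).
    2:{ unfold h. replace (-1) with (- (1)) by ring. rewrite exp_Ropp. field. pose proof (exp_pos 1). repeat split; nra. }
    pose proof exp_le_3 as H3.
    assert (INR m <= (K + 2) * L) by nra.
    assert (exp 1 * D * INR m <= 3 * D * ((K + 2) * L)).
    { pose proof (exp_pos 1). apply Rmult_le_compat; try lra.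
      - apply Rmult_le_pos; lra.
      - apply Rmult_le_compat_r; lra. }
    assert ((Lam + 2 * M) * (exp 1 * D * INR m) <= ((1 + 2 * K2) * (Lam + L)) * (3 * D * ((K + 2) * L))).
    { apply Rmult_le_compat; auto.
      - unfold M; lra.
      - apply Rmult_le_pos; [apply Rmult_le_pos; [apply Rlt_le, exp_pos | lra] | lra].
      - assert (0 <= K2 * Lam) by (apply Rmult_le_pos; lra). nra. }
    assert (1 <= L * (Lam + L)) by nra. lra.
  (* With length at least [Lam + 2 * M], the window shifted by any [ln t] between [ln delta] and
     [ln T] still contains [[-M, M]]. *)
  - set (a := - ln T - M).
    exists (fun j => h / c * exp (bet * (a + INR j * h))), (fun j => exp (a + INR j * h)).
    split.
    { intros j; split; [|apply exp_pos].
      apply Rmult_lt_0_compat; [apply Rdiv_lt_0_compat; lra | apply exp_pos]. }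
    intros t Ht.
    assert (Hnh : Lam + 2 * M <= INR n * h).
    { apply Rmult_le_reg_r with (/ h); [apply Rinv_0_lt_compat; lra|].
      replace (INR n * h * / h) with (INR n) by (field; lra). apply Hn. }
    assert (HlnT : ln t <= ln T) by (apply ln_le; lra).
    assert (Hlnd : ln delta <= ln t) by (apply ln_le; lra).
    assert (HLamE : Lam = ln T - ln delta) by (unfold Lam; rewrite ln_div; lra).
    assert (E := Htr (a + ln t) h M n m Hh Hm1).
    assert (Hs : h * D * INR m <= exp (-1)).
    { right. unfold h. field. split; [|lra]. intros H0. rewrite H0 in HDm. lra. }
    specialize (E Hs ltac:(unfold M; lra) ltac:(unfold a; lra) ltac:(unfold a; lra)).
    rewrite <- (Rsum_scal n h) in E.
    set (Pt := Rpower t (- bet)).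
    assert (HPt : 0 < Pt) by apply exp_pos.
    assert (Hsum : Rsum n (fun j => h / c * exp (bet * (a + INR j * h)) * exp (- exp (a + INR j * h) * t))
      = Pt / c * Rsum n (fun i => h * exp (bet * (a + ln t + INR i * h) - exp (a + ln t + INR i * h)))).
    { rewrite <- Rsum_scal. apply Rsum_ext. intros j _. unfold Pt, Rpower.
      replace (a + ln t + INR j * h) with (a + INR j * h + ln t) by ring.
      rewrite (exp_plus (a + INR j * h) (ln t)), exp_ln by lra.
      replace (h / c * exp (bet * (a + INR j * h)) * exp (- exp (a + INR j * h) * t))
        with (h / c * (exp (bet * (a + INR j * h)) * exp (- exp (a + INR j * h) * t))) by ring.
      rewrite <- exp_plus.
      match goal with |- _ = exp ?y / c * (h * exp ?z) =>
        replace (exp y / c * (h * exp z)) with (h / c * (exp y * exp z)) by (field; lra) end.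
      rewrite <- exp_plus. do 2 f_equal. ring. }
    rewrite Hsum.
    set (Sm := Rsum n _) in E |- *.
    replace (Pt / c * Sm - Pt) with (Pt / c * (Sm - c)) by (field; lra).
    rewrite Rabs_mult, (Rabs_right (Pt / c)) by (apply Rle_ge, Rdiv_le_0_compat; lra).
    apply Rle_trans with (Pt / c * (c * eps)); [|right; field; lra].
    apply Rmult_le_compat_l; [apply Rdiv_le_0_compat; lra|].
    eapply Rle_trans; [apply E|].
    assert (E1 : exp (- bet * M) <= exp (- K) * eps).
    { rewrite <- Heps, <- exp_plus. apply exp_le. unfold M.
      replace (- bet * ((L + K) / bet + 1)) with (- (L + K) - bet) by (field; lra). lra. }
    assert (E2 : exp (- INR m) <= exp (- K) * eps).
    { rewrite <- Heps, <- exp_plus. apply exp_le. lra. }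
    apply Rle_trans with (2 * C * exp (- K) * eps); [nra | nra].
Qed.

(** * One-dimensional heat kernel *)

(* Re (exp (i th) int exp (z^2) dz) along the horizontal segment from i y to x + i y. *)
Definition horizontal (th x y : R) : R :=
  RInt (fun s => x * (exp ((s * x) ^ 2 - y ^ 2) * cos (2 * (s * x) * y + th))) 0 1.

Lemma continuous_fst_comp (f : R -> R) (p : R * R) :
  continuous f (fst p) -> continuous (fun q : R * R => f (fst q)) p.
Proof. intros H. apply (continuous_comp fst f p); auto. apply continuous_fst. Qed.

(** If [F] is a primitive of [exp (z^2)], then [horizontal] is the real part of
    [exp (i th) (F (x + i y) - F (i y))]; the two summands are the contributions of the two ends of
    the segment. *)
Lemma is_derive_horizontal (th : R) (x y x' y' : R -> R) :
  (forall u, is_derive x u (x' u)) -> (forall u, is_derive y u (y' u)) ->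
  (forall u, continuous x' u) -> (forall u, continuous y' u) ->
  forall u, is_derive (fun u => horizontal th (x u) (y u)) u
    (exp (x u ^ 2 - y u ^ 2) * (x' u * cos (2 * x u * y u + th) - y' u * sin (2 * x u * y u + th))
     + exp (- y u ^ 2) * y' u * sin th).
Proof.
  intros Hx Hy Cx' Cy' u.
  assert (Ex : forall u, ex_derive x u) by (intros v; eexists; apply Hx).
  assert (Ey : forall u, ex_derive y u) by (intros v; eexists; apply Hy).
  set (psi := fun u s => x u * (exp ((s * x u) ^ 2 - y u ^ 2) * cos (2 * (s * x u) * y u + th))).
  set (D := fun u s => x' u * exp ((s * x u) ^ 2 - y u ^ 2) * cos (2 * (s * x u) * y u + th)
    + x u * exp ((s * x u) ^ 2 - y u ^ 2) *
      ((2 * s ^ 2 * x u * x' u - 2 * y u * y' u) * cos (2 * (s * x u) * y u + th)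
       - (2 * s * x' u * y u + 2 * s * x u * y' u) * sin (2 * (s * x u) * y u + th))).
  assert (HD : forall s u, is_derive (fun u => psi u s) u (D u s)).
  { intros s v. unfold psi, D. auto_derive; [repeat split; auto|].
    replace (Derive _ v) with (x' v) by (symmetry; now apply is_derive_unique).
    replace (Derive _ v) with (y' v) by (symmetry; now apply is_derive_unique).
    unfold Rminus. simpl pow. ring. }
  assert (HDD : forall s u, Derive (fun u => psi u s) u = D u s)
    by (intros; now apply is_derive_unique).
  assert (HI : is_RInt (D u) 0 1
    (exp (x u ^ 2 - y u ^ 2) * (x' u * cos (2 * x u * y u + th) - y' u * sin (2 * x u * y u + th))
     + exp (- y u ^ 2) * y' u * sin th)).
  (* With [w = s x + i y], [A] is the real part of [exp (i th) exp (w^2) dw/du]. It is an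
     [s]-primitive of [D] because the [u]-derivative of [exp (w^2) dw/ds] equals the [s]-derivative
     of [exp (w^2) dw/du]. *)
  { set (A := fun s => exp ((s * x u) ^ 2 - y u ^ 2) * (s * x' u * cos (2 * (s * x u) * y u + th)
      - y' u * sin (2 * (s * x u) * y u + th))).
    evar_last; [apply (is_RInt_derive A (D u))|].
    - intros s _. unfold A, D. auto_derive; auto. simpl pow. unfold Rminus. ring.
    - intros s _. apply (@ex_derive_continuous _ R_NormedModule). unfold D. auto_derive; auto.
    - change (minus (A 1) (A 0)) with (A 1 + - A 0). unfold A.
      rewrite !Rmult_1_l, !Rmult_0_l.
      replace (2 * 0 * y u + th) with th by ring.
      replace (0 ^ 2 - y u ^ 2) with (- y u ^ 2) by ring. ring. }
  rewrite <- (is_RInt_unique _ _ _ _ HI).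
  rewrite (RInt_ext (D u) (fun s => Derive (fun u => psi u s) u)) by (intros; now rewrite HDD).
  apply (is_derive_RInt_param psi 0 1 u).
  - exists (mkposreal 1 Rlt_0_1). intros v _ s _. eexists; apply HD.
  - intros s _. apply continuity_2d_pt_ext with D; [intros; now rewrite HDD|].
    apply continuity_2d_pt_filterlim.
    change (continuous (fun q : R * R => D (fst q) (snd q)) (u, s)).
    assert (Cx : continuous (fun q : R * R => x (fst q)) (u, s))
      by (apply continuous_fst_comp, (@ex_derive_continuous _ R_NormedModule), Ex).
    assert (Cy : continuous (fun q : R * R => y (fst q)) (u, s))
      by (apply continuous_fst_comp, (@ex_derive_continuous _ R_NormedModule), Ey).
    assert (Cdx : continuous (fun q : R * R => x' (fst q)) (u, s))
      by (apply continuous_fst_comp, Cx').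
    assert (Cdy : continuous (fun q : R * R => y' (fst q)) (u, s))
      by (apply continuous_fst_comp, Cy').
    assert (Cs : continuous (fun q : R * R => snd q) (u, s)) by apply continuous_snd.
    unfold D, Rminus.
    assert (Cexp : forall f : R * R -> R, continuous f (u, s) -> continuous (fun q => exp (f q)) (u, s)).
    { intros f Hf. apply (continuous_comp f exp); auto. apply (@ex_derive_continuous _ R_NormedModule). auto_derive; auto. }
    assert (Ccos : forall f : R * R -> R, continuous f (u, s) -> continuous (fun q => cos (f q)) (u, s)).
    { intros f Hf. apply (continuous_comp f cos); auto. apply (@ex_derive_continuous _ R_NormedModule). auto_derive; auto. }
    assert (Csin : forall f : R * R -> R, continuous f (u, s) -> continuous (fun q => sin (f q)) (u, s)).
    { intros f Hf. apply (continuous_comp f sin); auto. apply (@ex_derive_continuous _ R_NormedModule). auto_derive; auto. }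
    assert (Cmul : forall f g : R * R -> R, continuous f (u, s) -> continuous g (u, s) -> continuous (fun q => f q * g q) (u, s)).
    { intros f g Hf Hg. now apply (@continuous_mult _ R_AbsRing). }
    assert (Cadd : forall f g : R * R -> R, continuous f (u, s) -> continuous g (u, s) -> continuous (fun q => f q + g q) (u, s)).
    { intros f g Hf Hg. now apply (@continuous_plus _ _ R_NormedModule). }
    assert (Cneg : forall f : R * R -> R, continuous f (u, s) -> continuous (fun q => - f q) (u, s)).
    { intros f Hf. now apply (@continuous_opp _ _ R_NormedModule). }
    assert (Ccst : forall c : R, continuous (fun q : R * R => c) (u, s)) by (intros; apply continuous_const).
    simpl pow.
    repeat match goal with
      | |- continuous (fun q => exp _) _ => apply Cexp
      | |- continuous (fun q => cos _) _ => apply Ccos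
      | |- continuous (fun q => sin _) _ => apply Csin
      | |- continuous (fun q => Rplus _ _) _ => apply Cadd
      | |- continuous (fun q => Rmult _ _) _ => apply Cmul
      | |- continuous (fun q => Ropp _) _ => apply Cneg
      | |- _ => first [apply Ccst | assumption] end.
  - exists (mkposreal 1 Rlt_0_1). intros v _. apply (@ex_RInt_continuous R_CompleteNormedModule). intros s _.
    apply (@ex_derive_continuous _ R_NormedModule). unfold psi. auto_derive; auto.
Qed.

Lemma horizontal_bound th x y :
  Rabs (horizontal th x y) <= Rabs x * exp (x ^ 2 - y ^ 2).
Proof.
  unfold horizontal. replace (Rabs x * exp (x ^ 2 - y ^ 2)) with ((1 - 0) * (Rabs x * exp (x ^ 2 - y ^ 2))) by ring.
  apply (@norm_RInt_le_const R_NormedModule (fun s => x * (exp ((s * x) ^ 2 - y ^ 2) * cos (2 * (s * x) * y + th)))); [lra| |].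
  - intros s Hs. unfold norm; simpl; unfold abs; simpl. rewrite !Rabs_mult.
    apply Rmult_le_compat_l; [apply Rabs_pos|].
    rewrite (Rabs_right (exp _)) by (apply Rle_ge, Rlt_le, exp_pos).
    rewrite <- (Rmult_1_r (exp (x * (x * 1) - y * (y * 1)))).
    apply Rmult_le_compat; [apply Rlt_le, exp_pos | apply Rabs_pos | | apply Rabs_le, COS_bound].
    apply exp_le. assert (s * s <= 1) by nra. assert (0 <= x * x) by apply Rle_0_sqr. nra.
  - apply (@RInt_correct R_CompleteNormedModule), (@ex_RInt_continuous R_CompleteNormedModule). intros s _.
    apply (@ex_derive_continuous _ R_NormedModule). auto_derive; auto.
Qed.

(** The [Erf] term is the integral along the imaginary axis up to [i y]; it cancels the term of
    [horizontal] coming from the left end of the segment. The shift [- PI / 2] is the division by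
    [i]. At the ends of the contour the horizontal part is small and the increment of [Erf] is close
    to the Gaussian integral. *)
Lemma is_derive_contour_primitive (th : R) (Erf x y x' y' : R -> R) :
  (forall v, is_derive Erf v (exp (- v ^ 2))) ->
  (forall u, is_derive x u (x' u)) -> (forall u, is_derive y u (y' u)) ->
  (forall u, continuous x' u) -> (forall u, continuous y' u) ->
  forall u, is_derive (fun u => horizontal (th - PI / 2) (x u) (y u) + cos th * Erf (y u)) u
    (exp (x u ^ 2 - y u ^ 2) * (x' u * sin (2 * x u * y u + th) + y' u * cos (2 * x u * y u + th))).
Proof.
  intros HE Hx Hy Cx Cy u.
  evar_last.
  - apply @is_derive_plus; [now apply is_derive_horizontal with (x' := x') (y' := y')|].
    apply (is_derive_scal (fun u => Erf (y u)) u (cos th)).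
    apply (is_derive_comp Erf y); [apply HE | apply Hy].
  - unfold plus, scal; simpl. unfold mult; simpl.
    replace (2 * x u * y u + (th - PI / 2)) with (- (PI / 2 - (2 * x u * y u + th))) by ring.
    replace (th - PI / 2) with (- (PI / 2 - th)) by ring.
    rewrite cos_neg, !sin_neg, cos_shift, !sin_shift. ring.
Qed.

(* On z = cosh u / 2 + i sqrt 3 / 2 sinh u, [contour_re + i contour_im] is z^2 tau - z rho and
   [contour_integrand] is Re (exp (i th) (dz/du) / i exp (z^2 tau - z rho)).  Rescaling z by mu
   amounts to tau = mu^2 t, rho = mu r. *)
Definition contour_re (tau rho u : R) : R :=
  tau / 2 - tau / 4 * cosh (2 * u) - rho / 2 * cosh u.
Definition contour_im (tau rho u : R) : R :=
  sqrt 3 / 4 * tau * sinh (2 * u) - sqrt 3 / 2 * rho * sinh u.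
Definition contour_integrand (th tau rho u : R) : R :=
  exp (contour_re tau rho u) *
  (sqrt 3 / 2 * cosh u * cos (contour_im tau rho u + th)
   + 1 / 2 * sinh u * sin (contour_im tau rho u + th)).

Definition idx4 (x0 x1 x2 x3 : R) (i : nat) : R :=
  match i with 0 => x0 | 1 => x1 | 2 => x2 | _ => x3 end%nat.

Lemma sqrt3_facts : sqrt 3 * sqrt 3 = 3 /\ 0 <= sqrt 3 <= 2.
Proof.
  pose proof (sqrt_sqrt 3 ltac:(lra)) as H. pose proof (sqrt_pos 3). split; [auto|]. nra.
Qed.

(** The combination of [cosh] and [sinh] splits into two waves of frequencies 1 and -1 with phases
    shifted by [PI / 6]. The constant [tau / 2] of the exponent goes into the amplitude. The
    coefficients [s] are the moduli of [a + i b]; by the angle of the asymptotes they are twice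
    [|a|], so [kap = 1/4] leaves half of the decay of [R]. *)
Lemma contour_integrand_wave_comb th tau rho : 0 < tau -> 0 <= rho ->
  wave_comb 4 (idx4 (- tau / 8) (- tau / 8) (- rho / 4) (- rho / 4))
    (idx4 (sqrt 3 * tau / 8) (- sqrt 3 * tau / 8) (- sqrt 3 * rho / 4) (sqrt 3 * rho / 4))
    (idx4 (tau / 4) (tau / 4) (rho / 2) (rho / 2)) (idx4 2 (-2) 1 (-1))
    cosh 1 (1 / 4) 0 (2 * exp (tau / 2)) (contour_integrand th tau rho).
Proof.
  intros Ht Hr.
  set (a := idx4 _ _ _ _). set (b := idx4 _ _ _ _). set (s := idx4 _ _ _ _). set (e := idx4 _ _ _ _).
  replace (contour_integrand th tau rho) with
    (fun u => wave 4 a b e (exp (tau / 2) / 2) 1 (th - PI / 6) u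
              + wave 4 a b e (exp (tau / 2) / 2) (-1) (th + PI / 6) u).
  - replace (2 * exp (tau / 2)) with (exp (tau / 2) * (INR (fact 0) / (1 / 4) ^ 0)
      + exp (tau / 2) * (INR (fact 0) / (1 / 4) ^ 0)) by (simpl; field).
    pose proof (exp_pos (tau / 2)).
    apply wc_plus; apply wc_wave; auto; try lra;
      try (rewrite ?Rabs_Ropp, ?Rabs_R1; simpl; lra).
    + intros u. rewrite Rabs_right by lra. simpl. unfold cosh.
      pose proof (exp_pos u). pose proof (exp_pos (- u)). rewrite Rmult_1_l. nra.
    + rewrite Rabs_left; simpl; lra.
    + intros u. rewrite Rabs_right by lra. simpl. unfold cosh.
      pose proof (exp_pos u). pose proof (exp_pos (- u)). replace (-1 * u) with (- u) by ring. nra.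
  - apply functional_extensionality. intros u. unfold contour_integrand, wave.
    replace (expsum 4 b e u) with (contour_im tau rho u).
    2:{ unfold contour_im, expsum, b, e, sinh. simpl.
        replace (-2 * u) with (- (2 * u)) by ring. replace (-1 * u) with (- u) by ring.
        replace (1 * u) with u by ring. field. }
    assert (HR : contour_re tau rho u = tau / 2 + expsum 4 a e u).
    { unfold contour_re, expsum, a, e, cosh. simpl.
        replace (-2 * u) with (- (2 * u)) by ring. replace (-1 * u) with (- u) by ring.
        replace (1 * u) with u by ring. field. }
    rewrite HR, !exp_plus. set (I := contour_im tau rho u).
    replace (I + (th - PI / 6)) with ((I + th) - PI / 6) by ring.
    replace (I + (th + PI / 6)) with ((I + th) + PI / 6) by ring.
    generalize (I + th) as J. intros J.
    rewrite cos_minus, cos_plus, cos_PI6, sin_PI6. unfold cosh, sinh.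
    replace (-1 * u) with (- u) by ring. replace (1 * u) with u by ring. field.
Qed.

Lemma cosh_ge (u : R) : exp (Rabs u) / 2 <= cosh u.
Proof.
  unfold cosh. pose proof (exp_pos u). pose proof (exp_pos (- u)).
  unfold Rabs; destruct (Rcase_abs u); lra.
Qed.

Lemma cosh_le (u : R) : cosh u <= exp (Rabs u).
Proof.
  unfold cosh. unfold Rabs; destruct (Rcase_abs u).
  - assert (exp u <= exp (- u)) by (apply exp_le; lra). lra.
  - assert (exp (- u) <= exp u) by (apply exp_le; lra). lra.
Qed.

Lemma mul_exp_neg_sq_le (E : R) : E * exp (- (E ^ 2 / 64)) <= 8.
Proof.
  apply Rmult_le_reg_r with (exp (E ^ 2 / 64)); [apply exp_pos|].
  rewrite Rmult_assoc, <- exp_plus. replace (- (E ^ 2 / 64) + E ^ 2 / 64) with 0 by ring.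
  rewrite exp_0. pose proof (exp_ineq1_le (E ^ 2 / 64)). nra.
Qed.

Lemma mul_exp_neg_sq_le' (E : R) : E * exp (- (E ^ 2 / 32)) <= 8 * exp (- (E ^ 2 / 64)).
Proof.
  replace (- (E ^ 2 / 32)) with (- (E ^ 2 / 64) + - (E ^ 2 / 64)) by field.
  rewrite exp_plus, <- Rmult_assoc. apply Rmult_le_compat_r; [apply Rlt_le, exp_pos|].
  apply mul_exp_neg_sq_le.
Qed.

(** The term in [rho] is dropped from the exponent, having the right sign. Division and
    multiplication by [sqrt tau] express the rest through [E = sqrt tau * exp |u|], the only
    quantity that the later bounds use. *)
Definition contour_majorant (tau u : R) : R :=
  2 * exp (tau / 2) / sqrt tau * (sqrt tau * exp (Rabs u) * exp (- ((sqrt tau * exp (Rabs u)) ^ 2 / 16))).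

Lemma contour_majorant_global tau u : 0 < tau ->
  contour_majorant tau u <= 16 * exp (tau / 2) / sqrt tau.
Proof.
  intros Ht. pose proof (sqrt_lt_R0 tau Ht). pose proof (exp_pos (tau / 2)).
  unfold contour_majorant. set (E := sqrt tau * exp (Rabs u)).
  assert (0 < E) by (apply Rmult_lt_0_compat; [auto | apply exp_pos]).
  assert (E * exp (- (E ^ 2 / 16)) <= 8).
  { eapply Rle_trans; [|apply mul_exp_neg_sq_le with (E := E)].
    apply Rmult_le_compat_l; [lra|]. apply exp_le. nra. }
  replace (16 * exp (tau / 2) / sqrt tau) with (2 * exp (tau / 2) / sqrt tau * 8) by (field; lra).
  apply Rmult_le_compat_l; auto. apply Rdiv_le_0_compat; lra.
Qed.

(* Here E = sqrt tau * exp |u| and B = sqrt tau * exp (- |u|) at an endpoint u of the contour. *)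
Lemma contour_endpoint (q E B x y th : R) : 0 <= q -> 8 <= E -> 0 < B <= E / 16 ->
  x = (E + B) / 4 - q -> y ^ 2 = 3 / 16 * (E - B) ^ 2 ->
  exp (- y ^ 2) <= exp (- (E ^ 2 / 64)) /\
  exp (- q ^ 2) * Rabs (horizontal th x y) <= 8 * exp (- (E ^ 2 / 64)).
Proof.
  intros Hq HE HB Hx Hy. split; [apply exp_le; nra|].
  set (x0 := (E + B) / 4) in *.
  assert (Hx0 : 2 <= x0 <= E / 2) by (unfold x0; lra).
  (* As [B] is small against [E], [y^2] is nearly [3 x0^2]. The square of [x = x0 - q] then loses
     its [q^2] against [exp (- q^2)], and the remaining [exp (- 2 x0 q)] pays for [|x| <= x0 + q],
     however large [q] is. *)
  assert (Hxy : x0 ^ 2 - y ^ 2 <= - (E ^ 2 / 32)) by (rewrite Hy; unfold x0; nra).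
  apply Rle_trans with (exp (- q ^ 2) * (Rabs x * exp (x ^ 2 - y ^ 2))).
  { apply Rmult_le_compat_l; [apply Rlt_le, exp_pos | apply horizontal_bound]. }
  replace (exp (- q ^ 2) * (Rabs x * exp (x ^ 2 - y ^ 2)))
    with (Rabs x * (exp (- q ^ 2) * exp (x ^ 2 - y ^ 2))) by ring.
  rewrite <- exp_plus.
  replace (- q ^ 2 + (x ^ 2 - y ^ 2)) with (- (2 * x0 * q) + (x0 ^ 2 - y ^ 2)) by (rewrite Hx; ring).
  rewrite exp_plus.
  set (F := exp (- (2 * x0 * q))).
  assert (HF : 0 < F <= 1).
  { split; [apply exp_pos|]. unfold F. rewrite <- exp_0. apply exp_le. nra. }
  assert (HqF : q * F <= 1).
  { unfold F. apply Rmult_le_reg_r with (exp (2 * x0 * q)); [apply exp_pos|].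
    rewrite Rmult_assoc, <- exp_plus. replace (- (2 * x0 * q) + 2 * x0 * q) with 0 by ring.
    rewrite exp_0. pose proof (exp_ineq1_le (2 * x0 * q)). nra. }
  assert (Hxa : Rabs x <= x0 + q) by (apply Rabs_le; lra).
  apply Rle_trans with (E * exp (- (E ^ 2 / 32))); [|apply mul_exp_neg_sq_le'].
  rewrite <- Rmult_assoc. apply Rmult_le_compat.
  - apply Rmult_le_pos; [apply Rabs_pos | lra].
  - apply Rlt_le, exp_pos.
  - apply Rle_trans with ((x0 + q) * F); [apply Rmult_le_compat_r; lra|]. nra.
  - apply exp_le; auto.
Qed.

(** Far enough out, [16 tau <= E^2], so [exp (tau / 2)] uses up only half of the decay
    [exp (- E^2 / 16)]. *)
Lemma contour_majorant_endpoint tau u : 0 < tau -> exp (- Rabs u) * 16 <= exp (Rabs u) ->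
  sqrt tau * contour_majorant tau u <= 16 * exp (- ((sqrt tau * exp (Rabs u)) ^ 2 / 64)).
Proof.
  intros Ht Hu. pose proof (sqrt_lt_R0 tau Ht) as Hs.
  unfold contour_majorant. set (E := sqrt tau * exp (Rabs u)).
  assert (HE : 0 < E) by (apply Rmult_lt_0_compat; [auto | apply exp_pos]).
  assert (Htau : tau * 16 <= E ^ 2).
  { unfold E. rewrite <- (sqrt_sqrt tau) at 1 by lra.
    assert (P : exp (- Rabs u) * exp (Rabs u) = 1) by (rewrite <- exp_plus, <- exp_0; f_equal; ring).
    pose proof (exp_pos (Rabs u)).
    replace ((sqrt tau * exp (Rabs u)) ^ 2) with (sqrt tau * sqrt tau * (exp (Rabs u) * exp (Rabs u))) by ring.
    rewrite Rmult_assoc. rewrite (Rmult_assoc (sqrt tau) (sqrt tau)).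
    apply Rmult_le_compat_l; [lra|]. apply Rmult_le_compat_l; [lra|]. nra. }
  replace (sqrt tau * (2 * exp (tau / 2) / sqrt tau * (E * exp (- (E ^ 2 / 16)))))
    with (2 * (E * (exp (tau / 2) * exp (- (E ^ 2 / 16))))) by (field; lra).
  rewrite <- exp_plus.
  apply Rle_trans with (2 * (E * exp (- (E ^ 2 / 32)))).
  - apply Rmult_le_compat_l; [lra|]. apply Rmult_le_compat_l; [lra|]. apply exp_le. lra.
  - pose proof (mul_exp_neg_sq_le' E). lra.
Qed.

Lemma exp_neg_mul16_le u : 2 <= u -> exp (- u) * 16 <= exp u.
Proof.
  intros Hu. pose proof (exp_ineq1_le 1).
  assert (E : 16 <= exp (u + u)).
  { apply Rle_trans with (exp (1 + 1 + (1 + 1))); [|apply exp_le; lra].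
    rewrite !exp_plus. assert (4 <= exp 1 * exp 1) by nra. nra. }
  rewrite exp_plus in E.
  assert (P : exp (- u) * exp u = 1) by (rewrite <- exp_plus, <- exp_0; f_equal; ring).
  pose proof (exp_pos u). pose proof (exp_pos (- u)). nra.
Qed.

(** The constants depend on neither [tau] nor [rho], and [c] is the integral of [exp (- v^2)]. The
    bounds [-2] and [2] put the ends where [exp |u|] is at least 16 times [exp (- |u|)]; the bounds
    by 8 are those of [contour_endpoint]. *)
Lemma contour_trapezoid : exists c D, 0 < c /\ 1 <= D /\
  forall th tau rho a h n m, 0 < tau -> 0 <= rho -> 0 < h -> (1 <= m)%nat ->
    h * D * INR m <= exp (-1) -> a <= -2 -> 2 <= a + INR n * h ->
    8 <= sqrt tau * exp (- a) -> 8 <= sqrt tau * exp (a + INR n * h) ->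
    sqrt tau * Rabs (h * Rsum n (fun j => contour_integrand th tau rho (a + INR j * h))
          - cos th * c / sqrt tau * exp (- rho ^ 2 / (4 * tau)))
    <= 32 * (exp (- ((sqrt tau * exp (- a)) ^ 2 / 64)) + exp (- ((sqrt tau * exp (a + INR n * h)) ^ 2 / 64))
             + exp (- INR m) * (INR n * h) * exp (tau / 2)).
Proof.
  destruct (ex_antiderivative (fun v => exp (- v ^ 2))) as [Erf HErf]; [intros u; auto_derive; auto|].
  destruct (improper_integral (fun v => exp (- v ^ 2)) Erf (fun v => exp (- v ^ 2)) (fun v => - 2 * v * exp (- v ^ 2))
     (fun v => exp (- v ^ 2)) (fun v => 2 * v * exp (- v ^ 2))) as [c [Hc Htail]]; auto.
  { intros; apply exp_pos. }
  { intros u. auto_derive; auto. simpl pow. ring. }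
  { intros u. auto_derive; auto. simpl pow. ring. }
  { intros u Hu. pose proof (exp_pos (- u ^ 2)). nra. }
  { intros u Hu. pose proof (exp_pos (- u ^ 2)). nra. }
  { intros; apply Rlt_le, exp_pos. }
  { intros; apply Rlt_le, exp_pos. }
  exists c, (growth 4 1 (1 / 4)).
  split; [auto | split; [apply growth_ge1; lra|]].
  intros th tau rho a h n m Ht Hr Hh Hm Hs Ha Hb HEa HEb.
  set (st := sqrt tau) in *.
  assert (Hst : 0 < st) by (apply sqrt_lt_R0; auto).
  assert (Hst2 : st * st = tau) by (apply sqrt_sqrt; lra).
  destruct sqrt3_facts as [H3 H3'].
  (* Completing the square: [z^2 tau - z rho = (x + i y)^2 - q^2] with [x + i y = sqrt tau z - q],
     and [exp (- q^2)] is the Gaussian sought. *)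
  set (q := rho / (2 * st)).
  assert (Hq : 0 <= q) by (apply Rdiv_le_0_compat; lra).
  set (x := fun u => st / 2 * cosh u - q).
  set (y := fun u => st * (sqrt 3 / 2) * sinh u).
  set (P0 := fun u => horizontal (th - PI / 2) (x u) (y u) + cos th * Erf (y u)).
  assert (HP0 : forall u, is_derive P0 u (exp (x u ^ 2 - y u ^ 2) *
     (st / 2 * sinh u * sin (2 * x u * y u + th) + st * (sqrt 3 / 2) * cosh u * cos (2 * x u * y u + th)))).
  { intros u. apply (is_derive_contour_primitive th Erf x y (fun u => st / 2 * sinh u) (fun u => st * (sqrt 3 / 2) * cosh u)); auto.
    - intros v. unfold x, cosh, sinh. auto_derive; auto. field.
    - intros v. unfold y, cosh, sinh. auto_derive; auto. field.
    - intros v. apply (@ex_derive_continuous _ R_NormedModule). unfold sinh. auto_derive; auto.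
    - intros v. apply (@ex_derive_continuous _ R_NormedModule). unfold cosh. auto_derive; auto. }
  set (P := fun u => exp (- q ^ 2) / st * P0 u).
  assert (Hdup : forall u, exp (2 * u) = exp u * exp u)
    by (intros u; rewrite <- exp_plus; f_equal; ring).
  assert (Hdup' : forall u, exp (- (2 * u)) = exp (- u) * exp (- u))
    by (intros u; rewrite <- exp_plus; f_equal; ring).
  assert (Hinv : forall u, exp (- u) = / exp u) by (intros; apply exp_Ropp).
  assert (HP : forall u, is_derive P u (contour_integrand th tau rho u)).
  { intros u. evar_last; [apply (is_derive_scal P0 u (exp (- q ^ 2) / st)); apply HP0|].
    unfold scal; simpl; unfold mult; simpl. unfold contour_integrand.
    replace (contour_re tau rho u) with (- q ^ 2 + (x u ^ 2 - y u ^ 2)).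
    - replace (contour_im tau rho u) with (2 * x u * y u).
      + rewrite exp_plus. simpl. field. lra.
      + unfold contour_im, x, y, q, cosh, sinh. rewrite <- Hst2, Hdup, Hdup'. field. lra.
    - unfold contour_re, x, y, q, cosh, sinh. rewrite <- Hst2, Hdup, Hdup', Hinv.
      pose proof (exp_pos u).
      transitivity (- (rho / (2 * st)) ^ 2 + ((st / 2 * ((exp u + / exp u) / 2) - rho / (2 * st)) ^ 2
        - st * st * (sqrt 3 * sqrt 3 / 4) * ((exp u - / exp u) / 2) ^ 2)).
      + field. lra.
      + rewrite H3. field. lra. }
  assert (Etr := wave_trapezoid_error 4 (idx4 (- tau / 8) (- tau / 8) (- rho / 4) (- rho / 4))
    (idx4 (sqrt 3 * tau / 8) (- sqrt 3 * tau / 8) (- sqrt 3 * rho / 4) (sqrt 3 * rho / 4))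
    (idx4 (tau / 4) (tau / 4) (rho / 2) (rho / 2)) (idx4 2 (-2) 1 (-1))
    cosh 1 (1 / 4)).
  (* [X] is the length of the window times the global bound of the majorant. *)
  specialize (Etr) with (f := contour_integrand th tau rho) (P := P) (G := contour_majorant tau)
    (x := a) (h := h) (n := n) (m := m) (W := 2 * exp (tau / 2))
    (X := INR n * h * (16 * exp (tau / 2) / st)).
  assert (E : Rabs (h * Rsum n (fun j => contour_integrand th tau rho (a + INR j * h)) - (P (a + INR n * h) - P a))
    <= contour_majorant tau a + contour_majorant tau (a + INR n * h) + exp (- INR m) * (INR n * h * (16 * exp (tau / 2) / st))).
  { apply Etr; auto; try lra; clear Etr.
    - intros i Hi. destruct i as [|[|[|[|i]]]]; try lia; simpl; rewrite Rabs_left1; lra.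
    - intros i Hi. destruct i as [|[|[|[|i]]]]; try lia; simpl; apply Rabs_le; nra.
    - intros i Hi. destruct i as [|[|[|[|i]]]]; try lia; simpl; apply Rabs_le; lra.
    - intros u. unfold cosh. pose proof (exp_pos u). pose proof (exp_pos (- u)). lra.
    - now apply contour_integrand_wave_comb.
    - intros u. unfold contour_majorant. fold st.
      replace (2 * exp (tau / 2) / st * (st * exp (Rabs u) * exp (- ((st * exp (Rabs u)) ^ 2 / 16))))
        with (2 * exp (tau / 2) * (exp (Rabs u) * exp (- ((st * exp (Rabs u)) ^ 2 / 16)))) by (field; lra).
      pose proof (exp_pos (tau / 2)). pose proof (exp_pos (Rabs u)).
      apply Rmult_le_compat_l; [lra|].
      apply Rmult_le_compat; [pose proof (cosh_ge u); lra | apply Rlt_le, exp_pos | apply cosh_le|].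
      apply exp_le.
      assert (HS : expsum 4 (idx4 (- tau / 8) (- tau / 8) (- rho / 4) (- rho / 4)) (idx4 2 (-2) 1 (-1)) u +
         1 / 4 * expsum 4 (idx4 (tau / 4) (tau / 4) (rho / 2) (rho / 2)) (idx4 2 (-2) 1 (-1)) u
         = - (tau / 8) * cosh (2 * u) - rho / 4 * cosh u).
      { unfold expsum, cosh. simpl. replace (-2 * u) with (- (2 * u)) by ring. replace (-1 * u) with (- u) by ring.
        replace (1 * u) with u by ring. field. }
      rewrite HS. pose proof (cosh_ge u) as C1. pose proof (cosh_ge (2 * u)) as C2.
      rewrite Rabs_mult, (Rabs_right 2), Hdup in C2 by lra.
      replace ((st * exp (Rabs u)) ^ 2) with (tau * (exp (Rabs u) * exp (Rabs u))) by (rewrite <- Hst2; ring).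
      assert (0 <= rho / 4 * cosh u) by (apply Rmult_le_pos; lra).
      assert (tau / 8 * (exp (Rabs u) * exp (Rabs u) / 2) <= tau / 8 * cosh (2 * u)) by (apply Rmult_le_compat_l; lra).
      lra.
    - intros v Hv.
      apply Rle_trans with (h * Rsum n (fun _ => 16 * exp (tau / 2) / st)).
      + apply Rmult_le_compat_l; [lra|]. apply Rsum_le. intros; now apply contour_majorant_global.
      + rewrite Rsum_const. right; ring. }
  clear Etr.
  set (b := a + INR n * h) in *.
  assert (Rab : Rabs a = - a) by (apply Rabs_left; lra).
  assert (Rbb : Rabs b = b) by (apply Rabs_right; lra).
  pose proof (exp_neg_mul16_le (- a) ltac:(lra)) as Xa. pose proof (exp_neg_mul16_le b ltac:(lra)) as Xb.
  assert (Ga := contour_majorant_endpoint tau a Ht). rewrite Rab in Ga. specialize (Ga Xa). fold st in Ga.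
  assert (Gb := contour_majorant_endpoint tau b Ht). rewrite Rbb in Gb. specialize (Gb Xb). fold st in Gb.
  rewrite Ropp_involutive in Xa.
  pose proof (exp_pos a). pose proof (exp_pos (- b)).
  destruct (contour_endpoint q (st * exp (- a)) (st * exp a) (x a) (y a) (th - PI / 2)) as [Ya Za]; auto.
  { nra. }
  { unfold x, cosh. field. }
  { unfold y, sinh. transitivity (sqrt 3 * sqrt 3 / 16 * (st * exp (- a) - st * exp a) ^ 2); [field | rewrite H3; field]. }
  destruct (contour_endpoint q (st * exp b) (st * exp (- b)) (x b) (y b) (th - PI / 2)) as [Yb Zb]; auto.
  { nra. }
  { unfold x, cosh. field. }
  { unfold y, sinh. transitivity (sqrt 3 * sqrt 3 / 16 * (st * exp b - st * exp (- b)) ^ 2); [field | rewrite H3; field]. }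
  assert (Hsq3 : 1.5 <= sqrt 3).
  { destruct (Rle_dec 1.5 (sqrt 3)); auto. exfalso. nra. }
  assert (Hya : y a <= -1).
  { unfold y, sinh. assert (7.5 <= st * exp (- a) - st * exp a) by nra. nra. }
  assert (Hyb : 1 <= y b).
  { unfold y, sinh. assert (7.5 <= st * exp b - st * exp (- b)) by nra. nra. }
  specialize (Htail (y a) (y b) Hya Hyb).
  replace (- rho ^ 2 / (4 * tau)) with (- q ^ 2) by (unfold q; rewrite <- Hst2; field; lra).
  set (Q := exp (- q ^ 2)) in *.
  assert (HQ : 0 < Q <= 1).
  { split; [apply exp_pos|]. unfold Q. rewrite <- exp_0. apply exp_le. nra. }
  set (S := h * Rsum n _) in E |- *.
  set (ea := exp (- ((st * exp (- a)) ^ 2 / 64))) in *.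
  set (eb := exp (- ((st * exp b) ^ 2 / 64))) in *.
  (* At each end, 8 comes from the horizontal segment and 1 from the tail of [Erf]. The majorants
     add 16, which makes 25, below the stated 32. *)
  assert (HPP : st * Rabs (P b - P a - cos th * c / st * Q) <= 9 * (ea + eb)).
  { rewrite <- (Rabs_right st) at 1 by lra. rewrite <- Rabs_mult. unfold P, P0.
    match goal with |- Rabs ?z <= _ => replace z with
      (Q * horizontal (th - PI / 2) (x b) (y b) + - (Q * horizontal (th - PI / 2) (x a) (y a))
       + cos th * (Q * (Erf (y b) - Erf (y a) - c))) by (field; lra) end.
    eapply Rle_trans; [apply Rabs_triang|].
    eapply Rle_trans; [apply Rplus_le_compat_r, Rabs_triang|].
    rewrite Rabs_Ropp, !Rabs_mult, (Rabs_right Q) by lra.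
    assert (Rabs (cos th) <= 1) by (apply Rabs_le, COS_bound).
    pose proof (Rabs_pos (cos th)). pose proof (Rabs_pos (Erf (y b) - Erf (y a) - c)).
    assert (Rabs (cos th) * (Q * Rabs (Erf (y b) - Erf (y a) - c)) <= 1 * (1 * (ea + eb))).
    { apply Rmult_le_compat; try lra.
      - apply Rmult_le_pos; lra.
      - apply Rmult_le_compat; lra. }
    lra. }
  replace (S - cos th * c / st * Q) with ((S - (P b - P a)) + (P b - P a - cos th * c / st * Q)) by ring.
  apply Rle_trans with (st * (Rabs (S - (P b - P a)) + Rabs (P b - P a - cos th * c / st * Q))).
  { apply Rmult_le_compat_l; [lra | apply Rabs_triang]. }
  assert (st * Rabs (S - (P b - P a)) <= st * (contour_majorant tau a + contour_majorant tau b + exp (- INR m) * (INR n * h * (16 * exp (tau / 2) / st))))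
    by (apply Rmult_le_compat_l; lra).
  assert (E16 : st * (exp (- INR m) * (INR n * h * (16 * exp (tau / 2) / st))) = 16 * (exp (- INR m) * (INR n * h) * exp (tau / 2)))
    by (field; lra).
  assert (0 <= exp (- INR m) * (INR n * h) * exp (tau / 2)).
  { apply Rmult_le_pos; [apply Rmult_le_pos|]; try (apply Rlt_le, exp_pos). unfold b in Hb. lra. }
  assert (0 < ea) by apply exp_pos. assert (0 < eb) by apply exp_pos.
  lra.
Qed.

(** * Complex arithmetic and the approximant on the contour *)

Lemma fst_Csum n f : fst (Csum n f) = Rsum n (fun i => fst (f i)).
Proof. induction n as [|n IH]; simpl; auto. now rewrite IH. Qed.

Lemma snd_Csum n f : snd (Csum n f) = Rsum n (fun i => snd (f i)).
Proof. induction n as [|n IH]; simpl; auto. now rewrite IH. Qed.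

Lemma Cexp_add a b : Cmult (Cexp a) (Cexp b) = Cexp (Cplus a b).
Proof.
  unfold Cmult, Cexp, Cplus; simpl. rewrite exp_plus, cos_plus, sin_plus. f_equal; ring.
Qed.

Lemma Csqrt_square z : 0 < fst z -> Csqrt (Cmult z z) = z.
Proof.
  destruct z as [x y]; simpl; intros Hx. unfold Csqrt, Cmult, Cmod; simpl.
  replace (sqrt _) with x.
  - f_equal. field. lra.
  - symmetry. transitivity (sqrt (x * x)); [f_equal | apply sqrt_square; lra].
    replace ((x * x - y * y) * ((x * x - y * y) * 1) + (x * y + y * x) * ((x * y + y * x) * 1))
      with ((x * x + y * y) * (x * x + y * y)) by ring.
    rewrite sqrt_square by nra. field.
Qed.

Lemma square_in_slit_plane z : 0 < fst z -> in_slit_plane (Cmult z z).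
Proof.
  destruct z as [x y]; unfold in_slit_plane; simpl. intros Hx [H1 H2].
  assert (y = 0) by nra. subst. nra.
Qed.

Definition contour_point (mu u : R) : Cx := (mu * (1 / 2 * cosh u), mu * (sqrt 3 / 2 * sinh u)).

(** The weight is [A (dz/du) / i] on the hyperbola before scaling by [mu]. The imaginary part of a
    number is the real part of its product with [exp (- i PI / 2)], so both components are instances
    of [contour_integrand]. *)
Lemma contour_term (mu A t r u : R) : 0 < mu ->
  Cmult (A * (sqrt 3 / 2 * cosh u), A * - (1 / 2 * sinh u))
    (Cmult (Cexp (Cmult (Cmult (contour_point mu u) (contour_point mu u)) (RtoC t)))
       (Cexp (Copp (Cmult (Csqrt (Cmult (contour_point mu u) (contour_point mu u))) (RtoC r)))))
  = (A * contour_integrand 0 (mu ^ 2 * t) (mu * r) u,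
     A * contour_integrand (- (PI / 2)) (mu ^ 2 * t) (mu * r) u).
Proof.
  intros Hmu. rewrite Csqrt_square, Cexp_add.
  2:{ simpl. pose proof (cosh_ge u). pose proof (exp_pos (Rabs u)). apply Rmult_lt_0_compat; lra. }
  replace (Cplus _ _) with (contour_re (mu ^ 2 * t) (mu * r) u, contour_im (mu ^ 2 * t) (mu * r) u).
  - unfold Cmult, Cexp, contour_integrand; simpl. rewrite Rplus_0_r.
    set (I := contour_im _ _ _).
    replace (I + - (PI / 2)) with (- (PI / 2 - I)) by ring.
    rewrite cos_neg, sin_neg, cos_shift, sin_shift. f_equal; ring.
  - unfold Cplus, Cmult, Copp, RtoC, contour_point, contour_re, contour_im, cosh, sinh; simpl.
    replace (exp (2 * u)) with (exp u * exp u) by (rewrite <- exp_plus; f_equal; ring).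
    replace (exp (- (2 * u))) with (exp (- u) * exp (- u)) by (rewrite <- exp_plus; f_equal; ring).
    rewrite exp_Ropp. pose proof (exp_pos u). destruct sqrt3_facts as [H3 _].
    f_equal; [|field; lra].
    transitivity (mu * (mu * 1) * t * (1 / 16 * (exp u + / exp u) ^ 2 - (sqrt 3 * sqrt 3) / 16 * (exp u - / exp u) ^ 2)
      - mu * r * ((exp u + / exp u) / 4)); [rewrite H3|]; field; lra.
Qed.

Lemma heat_kernel_1d : exists C, 0 < C /\
  forall eps T delta : R, 0 < eps -> eps < 0.1 -> 0 < delta -> 1000 * delta <= T ->
  exists N : nat, (1 <= N)%nat /\
    INR N <= C * ln (T / delta) * (ln (1 / eps) + ln (ln (T / delta))) /\
    exists w s : Z -> Cx, (forall k, in_slit_plane (s k)) /\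
      forall r t, 0 <= r -> delta <= t <= T ->
        let Q := Csum (2 * N + 1) (fun i =>
          let k := (Z.of_nat i - Z.of_nat N)%Z in
          Cmult (w k) (Cmult (Cexp (Cmult (s k) (RtoC t)))
                             (Cexp (Copp (Cmult (Csqrt (s k)) (RtoC r)))))) in
        Rabs (fst Q - exp (- (r ^ 2) / (4 * t)) / sqrt t) <= eps / sqrt t /\
        Rabs (snd Q) <= eps / sqrt t.
Proof.
  destruct contour_trapezoid as [c [D [Hc [HD Htr]]]].
  (* Three error terms, each with the factor 32, are absorbed: [96 * exp (- K) <= c]. *)
  set (K := ln (1 + 96 / c)).
  assert (Hc96 : 0 < 96 / c) by (apply Rdiv_lt_0_compat; lra).
  assert (HK : 0 <= K) by (unfold K; rewrite <- ln_1; apply ln_le; lra).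
  assert (HKe : 96 * exp (- K) <= c).
  { unfold K. rewrite exp_Ropp, exp_ln by lra.
    apply Rmult_le_reg_r with (1 + 96 / c); [lra|].
    replace (96 * / (1 + 96 / c) * (1 + 96 / c)) with 96 by (field; lra).
    replace (c * (1 + 96 / c)) with (c + 96) by (field; lra). lra. }
  set (K3 := ln (64 * (1 + K)) + 3).
  assert (HK3 : 3 <= K3).
  { unfold K3. assert (0 <= ln (64 * (1 + K))); [rewrite <- ln_1; apply ln_le|]; lra. }
  set (K4 := 3 + K + ln (1 + K3)).
  assert (Hl3 : 0 <= ln (1 + K3)) by (rewrite <- ln_1; apply ln_le; lra).
  assert (HA : 0 <= (1 + K3) * (3 * D * K4)) by (unfold K4; repeat apply Rmult_le_pos; lra).
  exists ((1 + K3) * (3 * D * K4) + 1). split; [lra|].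
  intros eps T delta He1 He2 Hd HT.
  pose proof (ln_inv_eps_ge eps He1 He2) as HL.
  pose proof (ln_ratio_ge T delta Hd HT) as HLam.
  pose proof (exp_neg_ln_inv eps He1) as Heps.
  assert (HeLam : exp (ln (T / delta)) = T / delta) by (apply exp_ln, Rdiv_lt_0_compat; lra).
  set (L := ln (1 / eps)) in *. set (Lam := ln (T / delta)) in *.
  assert (HlL : 0 <= ln Lam) by (rewrite <- ln_1; apply ln_le; lra).
  (* Chosen so that [tau * exp (2 * U) >= 64 * L * (1 + K)], since [tau >= L * delta / T]; both
     endpoint errors are then at most [eps * exp (- K)]. *)
  set (U := (Lam + ln (64 * (1 + K))) / 2).
  assert (HU : 3 <= U) by (unfold U; unfold K3 in HK3; lra).
  assert (HU3 : 2 * U + 3 = Lam + K3) by (unfold U, K3; lra).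
  (* Of [3 / 2 * L], one [L] yields the accuracy and one half compensates [exp (tau / 2)]; the
     logarithm compensates the length of the window, at most [2 * (U + 1) + h]. *)
  set (y := 3 / 2 * L + K + ln (2 * U + 3)).
  assert (Hly : 0 <= ln (2 * U + 3) <= ln (1 + K3) + ln Lam).
  { split; [rewrite <- ln_1; apply ln_le; lra|]. rewrite <- ln_mult by lra. apply ln_le; nra. }
  destruct (nat_ceil y) as [m [Hm1 Hm]]; [unfold y; lra|].
  assert (HmK : INR m <= K4 * (L + ln Lam)).
  { apply Rle_trans with (3 / 2 * L + K + (ln (1 + K3) + ln Lam) + 1); [unfold y in Hm; lra|].
    unfold K4. assert (0 <= K * (L + ln Lam - 1)) by (apply Rmult_le_pos; lra).
    assert (0 <= ln (1 + K3) * (L + ln Lam - 1)) by (apply Rmult_le_pos; lra). lra. }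
  set (h := exp (-1) / (D * INR m)).
  pose proof (exp_pos (-1)) as He.
  assert (He' : exp (-1) <= 1) by (rewrite <- exp_0; apply exp_le; lra).
  assert (Hmy : 1 <= INR m) by (unfold y in Hm; lra).
  assert (HDm : 1 <= D * INR m) by nra.
  assert (Hh : 0 < h <= 1).
  { unfold h. split; [apply Rdiv_lt_0_compat; lra|].
    apply Rmult_le_reg_r with (D * INR m); [lra|].
    replace (exp (-1) / (D * INR m) * (D * INR m)) with (exp (-1)) by (field; split; lra). lra. }
  destruct (nat_ceil (U / h)) as [N [HN1 HN]]; [apply Rdiv_le_0_compat; lra|].
  assert (HNh : U <= INR N * h <= U + 1).
  { assert (Hx : U = U / h * h) by (field; lra). rewrite Hx at 1 2. split; nra. }
  exists N. split; auto. split.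
  { apply Rle_trans with (U / h + 1); [lra|].
    replace (U / h) with (U * (exp 1 * D * INR m)).
    2:{ unfold h. replace (-1) with (- (1)) by ring. rewrite exp_Ropp. field. pose proof (exp_pos 1). repeat split; nra. }
    pose proof exp_le_3 as H3. pose proof (exp_pos 1).
    assert (E1 : exp 1 * D * INR m <= 3 * D * (K4 * (L + ln Lam))).
    { apply Rmult_le_compat; try lra.
      - apply Rmult_le_pos; lra.
      - apply Rmult_le_compat_r; lra. }
    assert (E2 : U * (exp 1 * D * INR m) <= ((1 + K3) * Lam) * (3 * D * (K4 * (L + ln Lam)))).
    { apply Rmult_le_compat; auto; [lra| |nra].
      apply Rmult_le_pos; [apply Rmult_le_pos|]; lra. }
    assert (1 <= Lam * (L + ln Lam)) by nra. lra. }
  set (mu := sqrt (L / T)).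
  assert (HLT : 0 < L / T) by (apply Rdiv_lt_0_compat; lra).
  assert (Hmu : 0 < mu) by (apply sqrt_lt_R0; auto).
  assert (Hmu2 : mu ^ 2 = L / T) by (unfold mu; simpl; rewrite Rmult_1_r; apply sqrt_sqrt; lra).
  (* Scaling of [dz], step size, and normalization of the Gaussian integral. *)
  set (A := mu * h / c).
  exists (fun k => (A * (sqrt 3 / 2 * cosh (IZR k * h)), A * - (1 / 2 * sinh (IZR k * h)))),
    (fun k => Cmult (contour_point mu (IZR k * h)) (contour_point mu (IZR k * h))).
  split.
  { intros k. apply square_in_slit_plane. simpl.
    pose proof (cosh_ge (IZR k * h)). pose proof (exp_pos (Rabs (IZR k * h))).
    apply Rmult_lt_0_compat; lra. }
  intros r t Hr Ht Q.
  assert (Ht0 : 0 < t) by lra.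
  pose proof (sqrt_lt_R0 t Ht0) as Hst.
  set (tau := mu ^ 2 * t). set (rho := mu * r).
  assert (Htau : 0 < tau) by (unfold tau; rewrite Hmu2; apply Rmult_lt_0_compat; lra).
  assert (HtauL : tau <= L).
  { unfold tau. rewrite Hmu2. replace L with (L / T * T) at 2 by (field; lra).
    apply Rmult_le_compat_l; lra. }
  assert (Hsqtau : sqrt tau = mu * sqrt t).
  { unfold tau. rewrite sqrt_mult by (try apply pow2_ge_0; lra). f_equal. apply sqrt_pow2; lra. }
  (* The nodes [-N, ..., N] form a left-endpoint rule, whose interval ends one step later, at
     [(N + 1) h]. *)
  set (a := - INR N * h). set (n := (2 * N + 1)%nat) in *.
  assert (Hn : INR n = 2 * INR N + 1) by (unfold n; rewrite plus_INR, mult_INR; simpl; ring).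
  (* Treats both components at once: [cos th] is 1 for the real part, with [th = 0], and 0 for the
     imaginary part, with [th = - PI / 2]. *)
  assert (HQ : forall th (f : Cx -> R),
    (f Q = Rsum n (fun i => A * contour_integrand th tau rho (a + INR i * h))) ->
    Rabs (f Q - cos th * (exp (- (r ^ 2) / (4 * t)) / sqrt t)) <= eps / sqrt t).
  { intros th f Hf. rewrite Hf, Rsum_scal.
    assert (HE : forall v, U <= v -> 64 * (L + K) <= (sqrt tau * exp v) ^ 2).
    { intros v Hv. replace ((sqrt tau * exp v) ^ 2) with (sqrt tau * sqrt tau * (exp v * exp v)) by ring.
      rewrite sqrt_sqrt, <- exp_plus by lra.
      assert (E1 : T / delta * (64 * (1 + K)) <= exp (v + v)).
      { rewrite <- HeLam. rewrite <- (exp_ln (64 * (1 + K))) by lra. rewrite <- exp_plus.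
        apply exp_le. unfold U in Hv. lra. }
      assert (E2 : L / T * delta <= tau) by (unfold tau; rewrite Hmu2; apply Rmult_le_compat_l; lra).
      apply Rle_trans with (L / T * delta * (T / delta * (64 * (1 + K)))).
      - replace (L / T * delta * (T / delta * (64 * (1 + K)))) with (L * (64 * (1 + K))) by (field; lra). nra.
      - apply Rmult_le_compat; auto.
        + apply Rmult_le_pos; lra.
        + apply Rmult_le_pos; [apply Rdiv_le_0_compat|]; lra. }
    assert (HE8 : forall v, U <= v -> 8 <= sqrt tau * exp v).
    { intros v Hv. specialize (HE v Hv).
      assert (0 < sqrt tau * exp v) by (apply Rmult_lt_0_compat; [apply sqrt_lt_R0; auto | apply exp_pos]). nra. }
    assert (Hb : a + INR n * h = INR N * h + h) by (rewrite Hn; unfold a; ring).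
    assert (Ha : - a = INR N * h) by (unfold a; ring).
    specialize (Htr th tau rho a h n m Htau ltac:(unfold rho; nra) ltac:(lra) Hm1).
    assert (Hs : h * D * INR m <= exp (-1)) by (right; unfold h; field; split; lra).
    rewrite Hb, Ha in Htr.
    specialize (Htr Hs ltac:(unfold a; lra) ltac:(lra) (HE8 (INR N * h) ltac:(lra)) (HE8 (INR N * h + h) ltac:(lra))).
    assert (HeK : forall v, L + K <= v -> exp (- v) <= eps * exp (- K)).
    { intros v Hv. rewrite <- Heps, <- exp_plus. apply exp_le. lra. }
    assert (F1 := HeK ((sqrt tau * exp (INR N * h)) ^ 2 / 64) ltac:(pose proof (HE (INR N * h) ltac:(lra)); lra)).
    assert (F2 := HeK ((sqrt tau * exp (INR N * h + h)) ^ 2 / 64) ltac:(pose proof (HE (INR N * h + h) ltac:(lra)); lra)).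
    assert (F3 : exp (- INR m) * (INR n * h) * exp (tau / 2) <= eps * exp (- K)).
    { apply Rle_trans with (exp (- INR m) * exp (ln (2 * U + 3)) * exp (tau / 2)).
      - apply Rmult_le_compat_r; [apply Rlt_le, exp_pos|].
        apply Rmult_le_compat_l; [apply Rlt_le, exp_pos|]. rewrite exp_ln by lra. rewrite Hn. nra.
      - rewrite <- Heps, <- !exp_plus. apply exp_le. unfold y in Hm. lra. }
    set (S := Rsum n _) in Htr |- *.
    replace (- rho ^ 2 / (4 * tau)) with (- (r ^ 2) / (4 * t)) in Htr by (unfold rho, tau; field; split; lra).
    rewrite Hsqtau in Htr at 1. rewrite Hsqtau in Htr at 1.
    set (ex := exp (- (r ^ 2) / (4 * t))) in *.
    replace (A * S - cos th * (ex / sqrt t)) with (mu / c * (h * S - cos th * c / (mu * sqrt t) * ex))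
      by (unfold A; field; repeat split; lra).
    rewrite Rabs_mult, (Rabs_right (mu / c)) by (apply Rle_ge, Rdiv_le_0_compat; lra).
    apply Rmult_le_reg_l with (c * sqrt t); [apply Rmult_lt_0_compat; lra|].
    replace (c * sqrt t * (eps / sqrt t)) with (c * eps) by (field; lra).
    match goal with |- c * sqrt t * (mu / c * ?z) <= _ => replace (c * sqrt t * (mu / c * z)) with (mu * sqrt t * z) by (field; lra) end.
    apply Rle_trans with (96 * exp (- K) * eps); [lra|]. nra. }
  assert (HQ' : Q = Csum n (fun i => (A * contour_integrand 0 tau rho (a + INR i * h),
      A * contour_integrand (- (PI / 2)) tau rho (a + INR i * h)))).
  { unfold Q. f_equal. apply functional_extensionality. intros i. cbv zeta.
    replace (IZR (Z.of_nat i - Z.of_nat N) * h) with (a + INR i * h)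
      by (rewrite minus_IZR, <- !INR_IZR_INZ; unfold a; ring).
    apply contour_term; auto. }
  split.
  - replace (exp (- (r ^ 2) / (4 * t)) / sqrt t) with (cos 0 * (exp (- (r ^ 2) / (4 * t)) / sqrt t)) by (rewrite cos_0; ring).
    apply (HQ 0 fst). rewrite HQ'. apply fst_Csum.
  - replace (snd Q) with (snd Q - cos (- (PI / 2)) * (exp (- (r ^ 2) / (4 * t)) / sqrt t))
      by (rewrite cos_neg, cos_PI2; ring).
    apply (HQ (- (PI / 2)) snd). rewrite HQ'. apply snd_Csum.
Qed.

(** * Product of the two factors *)

Lemma heat_kernel_factor (d : nat) (x : nat -> R) (t : R) : 0 < t ->
  heat_kernel d x t = Rpower (4 * PI) (- (INR d / 2)) *
    (Rpower t (- ((INR d - 1) / 2)) * (exp (- (norm_d d x ^ 2) / (4 * t)) / sqrt t)).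
Proof.
  intros Ht. unfold heat_kernel. pose proof PI_RGT_0 as Hpi.
  rewrite <- Rpower_mult_distr, Rinv_mult, <- !Rpower_Ropp by lra.
  replace (- (INR d / 2)) with (- ((INR d - 1) / 2) + - / 2) at 2 by field.
  rewrite Rpower_plus, (Rpower_Ropp t (/ 2)), Rpower_sqrt by auto.
  unfold Rdiv. ring.
Qed.

Lemma Cmod_le_abs (z : Cx) : Cmod z <= Rabs (fst z) + Rabs (snd z).
Proof.
  unfold Cmod. pose proof (Rabs_pos (fst z)). pose proof (Rabs_pos (snd z)).
  rewrite <- (sqrt_pow2 (Rabs (fst z) + Rabs (snd z))) by lra.
  apply sqrt_le_1_alt.
  rewrite <- (pow2_abs (fst z)), <- (pow2_abs (snd z)). nra.
Qed.

Lemma Csum_real_mul (n : nat) (p : nat -> R) (q : Cx) :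
  Csum n (fun j => Cmult (RtoC (p j)) q) = (Rsum n p * fst q, Rsum n p * snd q).
Proof.
  induction n as [|n IH]; simpl; [f_equal; ring|].
  rewrite IH. unfold Cplus, Cmult, RtoC; simpl. f_equal; ring.
Qed.

Theorem theorem2 :
  forall d : nat, (2 <= d)%nat ->
  exists Cd : R, 0 < Cd /\
  forall eps T delta : R,
    0 < eps -> eps < 0.1 -> 0 < delta -> 1000 * delta <= T ->
    exists N1 N2 : nat,
      (1 <= N1)%nat /\ (1 <= N2)%nat /\
      INR N1 <= Cd * ln (T / delta) * (ln (1 / eps) + ln (ln (T / delta))) /\
      INR N2 <= Cd * ln (1 / eps) * (ln (T / delta) + ln (1 / eps)) /\
      exists (wt lam : nat -> R) (w s : Z -> Cx),
        (forall j : nat, (1 <= j <= N2)%nat -> 0 < wt j /\ 0 < lam j) /\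
        (forall k : Z, (- Z.of_nat N1 <= k <= Z.of_nat N1)%Z -> in_slit_plane (s k)) /\
        (forall (x : nat -> R) (t : R), delta <= t <= T ->
           Cmod (Cplus (RtoC (heat_kernel d x t))
                       (Copp (approx_kernel d N1 N2 wt lam w s x t)))
           < eps / Rpower t (INR d / 2)).
Proof.
  intros d Hd. set (bet := (INR d - 1) / 2).
  assert (HdR : 2 <= INR d) by (change 2 with (INR 2); apply le_INR; auto).
  assert (Hbet : 0 < bet) by (unfold bet; lra).
  destruct heat_kernel_1d as [C1 [HC1 H1]].
  destruct (power_sum_of_exponentials bet Hbet) as [C2 [HC2 H2]].
  (* Both factors are used at accuracy [eps / 4], and [ln (4 / eps) <= 2 * ln (1 / eps)]: this costs
     2 in [N1] and, appearing twice, 4 in [N2]. *)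
  exists (2 * C1 + 4 * C2). split; [lra|].
  intros eps T delta He1 He2 Hdel HT.
  pose proof (ln_inv_eps_ge eps He1 He2) as HL.
  pose proof (ln_ratio_ge T delta Hdel HT) as HLam.
  assert (HlL : 0 <= ln (ln (T / delta))) by (rewrite <- ln_1; apply ln_le; lra).
  destruct (H1 (eps / 4) T delta ltac:(lra) ltac:(lra) Hdel HT) as [N1 [HN1 [B1 [w [s [Hs E1]]]]]].
  destruct (H2 (eps / 4) T delta ltac:(lra) ltac:(lra) Hdel HT) as [N2 [HN2 [B2 [wt [lam [Hw E2]]]]]].
  assert (HL4 : 0 <= ln (1 / (eps / 4)) <= 2 * ln (1 / eps)).
  { assert (1 <= 1 / eps) by (apply Rmult_le_reg_r with eps; auto; replace (1 / eps * eps) with 1 by (field; lra); lra).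
    assert (4 <= 1 / eps) by (apply Rmult_le_reg_r with eps; auto; replace (1 / eps * eps) with 1 by (field; lra); lra).
    replace (1 / (eps / 4)) with (4 * (1 / eps)) by (field; lra).
    replace (2 * ln (1 / eps)) with (ln (1 / eps) + ln (1 / eps)) by ring.
    rewrite <- ln_mult by lra. split; [rewrite <- ln_1|]; apply ln_le; nra. }
  exists N1, N2. split; [auto | split; [auto | split; [|split]]].
  - eapply Rle_trans; [apply B1|].
    set (L := ln (1 / eps)) in *. set (L4 := ln (1 / (eps / 4))) in *.
    set (Lam := ln (T / delta)) in *. set (l := ln Lam) in *.
    apply Rle_trans with (C1 * Lam * (2 * (L + l))).
    + apply Rmult_le_compat_l; [apply Rmult_le_pos|]; lra.
    + assert (0 <= C2 * Lam * (L + l)) by (repeat apply Rmult_le_pos; lra). lra.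
  - eapply Rle_trans; [apply B2|].
    set (L := ln (1 / eps)) in *. set (L4 := ln (1 / (eps / 4))) in *.
    set (Lam := ln (T / delta)) in *.
    apply Rle_trans with (C2 * (2 * L) * (2 * (Lam + L))).
    + apply Rmult_le_compat; try lra; [apply Rmult_le_pos; lra | apply Rmult_le_compat_l; lra].
    + assert (0 <= C1 * L * (Lam + L)) by (repeat apply Rmult_le_pos; lra). lra.
  - set (kap := Rpower (4 * PI) (- (INR d / 2))).
    assert (Hkap : 0 < kap <= 1).
    { split; [apply exp_pos|]. unfold kap. rewrite <- (Rpower_O (4 * PI)) by (pose proof PI_RGT_0; lra).
      apply Rle_Rpower; [pose proof PI2_3_2|]; lra. }
    (* The power of [4 PI] moves into the weights, and [pred] undoes the numbering from 1 in
       [approx_kernel]. *)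
    exists (fun j => kap * wt (pred j)), (fun j => lam (pred j)), w, s.
    split; [|split; auto].
    { intros j _. destruct (Hw (pred j)). split; auto. apply Rmult_lt_0_compat; lra. }
    intros x t Ht. assert (Ht0 : 0 < t) by lra.
    unfold approx_kernel.
    destruct (E1 (norm_d d x) t (sqrt_pos _) Ht) as [Q1 Q2].
    specialize (E2 t Ht).
    cbv zeta in Q1, Q2 |- *. set (Q := Csum (2 * N1 + 1) _) in *.
    rewrite Csum_real_mul. simpl pred.
    rewrite (Rsum_ext N2 _ (fun j => kap * (wt j * exp (- lam j * t)))) by (intros; ring).
    rewrite Rsum_scal, heat_kernel_factor by auto. fold kap bet.
    set (p := Rsum N2 _) in *. set (p0 := Rpower t (- bet)) in *.
    set (g := exp (- norm_d d x ^ 2 / (4 * t)) / sqrt t) in *.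
    pose proof (sqrt_lt_R0 t Ht0) as Hst.
    assert (Hp0 : 0 < p0) by apply exp_pos.
    set (v := / sqrt t). assert (Hv : 0 < v) by (apply Rinv_0_lt_compat; auto).
    (* The power sum has a relative error, but [Q] is accurate only relative to [1 / sqrt t]; this
       bound lets every error be measured in units of [p0 * v]. *)
    assert (Hg : 0 <= g <= v).
    { unfold g, Rdiv. fold v. split.
      - apply Rmult_le_pos; [apply Rlt_le, exp_pos | lra].
      - rewrite <- (Rmult_1_l v) at 2. apply Rmult_le_compat_r; [lra|].
        rewrite <- exp_0. apply exp_le.
        replace (- norm_d d x ^ 2 * / (4 * t)) with (- (norm_d d x ^ 2 / (4 * t))) by (unfold Rdiv; ring).
        assert (0 <= norm_d d x ^ 2 / (4 * t)) by (apply Rdiv_le_0_compat; [apply pow2_ge_0 | lra]). lra. }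
    replace (eps / Rpower t (INR d / 2)) with (eps * (p0 * v)).
    2:{ unfold p0, v. replace (INR d / 2) with (bet + / 2) by (unfold bet; field).
        rewrite Rpower_plus, Rpower_sqrt, Rpower_Ropp by auto. field.
        split; [|apply Rgt_not_eq, exp_pos]; lra. }
    replace (eps / 4 / sqrt t) with (eps / 4 * v) in Q1, Q2 by (unfold v; field; lra).
    assert (Hp : Rabs p <= p0 * (1 + eps / 4)).
    { replace p with ((p - p0) + p0) by ring. eapply Rle_trans; [apply Rabs_triang|].
      rewrite (Rabs_right p0) by lra. lra. }
    eapply Rle_lt_trans; [apply Cmod_le_abs|]. simpl.
    replace (0 + - (kap * p * snd Q)) with (kap * (- (p * snd Q))) by ring.
    replace (kap * (p0 * g) + - (kap * p * fst Q))
      with (kap * (- (p * (fst Q - g)) + - (g * (p - p0)))) by ring.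
    rewrite !(Rabs_mult kap), (Rabs_right kap), <- Rmult_plus_distr_l by lra.
    assert (T1 : Rabs (- (p * (fst Q - g))) <= p0 * (1 + eps / 4) * (eps / 4 * v)).
    { rewrite Rabs_Ropp, Rabs_mult. apply Rmult_le_compat; auto; apply Rabs_pos. }
    assert (T2 : Rabs (- (g * (p - p0))) <= v * (eps / 4 * p0)).
    { rewrite Rabs_Ropp, Rabs_mult, (Rabs_right g) by lra.
      apply Rmult_le_compat; auto; try lra. apply Rabs_pos. }
    assert (T3 : Rabs (- (p * snd Q)) <= p0 * (1 + eps / 4) * (eps / 4 * v)).
    { rewrite Rabs_Ropp, Rabs_mult. apply Rmult_le_compat; auto; apply Rabs_pos. }
    pose proof (Rabs_triang (- (p * (fst Q - g))) (- (g * (p - p0)))) as T4.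
    assert (Hpv : 0 < p0 * v) by (apply Rmult_lt_0_compat; auto).
    (* The sum of [T1], [T2] and [T3]; strictness comes from [2 * (eps / 4)^2 < eps / 4]. *)
    apply Rle_lt_trans with (1 * ((3 * (eps / 4) + 2 * (eps / 4) ^ 2) * (p0 * v))).
    + apply Rmult_le_compat; try lra.
      apply Rplus_le_le_0_compat; apply Rabs_pos.
    + rewrite Rmult_1_l. apply Rmult_lt_compat_r; auto. nra.
Qed.
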